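(* Let $q$ be a power of a prime. Then $$N_{q^3}(U_5(q))=q(q-1)(2q-1),\qquad N_{q^3}(U_6(q))=q^2(q-1)(4q^2+q-3),$$ $$N_{q^3}(U_7(q))=q^2(q-1)\left[3q^4+6q^3-2q^2-5q+1\right],$$ and for all integers $n\ge 8$ $$\begin{aligned}N_{q^3}(U_n(q)) = {}& q\,N_{q^3}(U_{n-1}(q)) + q^{n-5}(q-1)\Big\{ q^5+(2n-14)q^4+\Big[25-3n+\tfrac{(n-6)(n-5)}{2}\Big]q^3\\ &+\big[n-11-(n-7)(n-6)\big]q^2+\Big[5-n+\tfrac{(n-8)(n-7)}{2}\Big]q+n-6\Big\}.\end{aligned}$$ Consequently, for all $n\ge 7$, $$N_{q^3}(U_n(q)) = q^{n-5}(q-1)\left\{A_nq^5+B_nq^4+C_nq^3+D_nq^2+E_nq+F_n\right\},$$ where $$\begin{aligned} A_n&=n-7,\\ B_n&=3+(n-7)(n-6),\\ C_n&=40(n-7)-\tfrac{17}{4}(n+8)(n-7)+\tfrac{1}{12}n(n+1)(2n+1)-64,\\ D_n&=(n-7)(7n+3)-\tfrac16 n(n+1)(2n+1)+138,\\ E_n&=(n-7)\left(-\tfrac{17}{4}n-1\right)+\tfrac1{12}n(n+1)(2n+1)-75,\\ F_n&=1+\tfrac{(n-7)(n-4)}{2}. \end{aligned}$$ Moreover $A_n,B_n,C_n,D_n,E_n,F_n$ are integers for every integer $n$, so $N_{q^3}(U_n(q))$ is a polynomial in $q$ with integer coefficients depending only on $n$.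
   Context: For a prime power $q$, $U_n(q)$ denotes the group of upper triangular $n\times n$ matrices over the finite field $\mathbf{F}_q$ all of whose diagonal entries equal $1$. For a finite group $G$ and a positive integer $k$, $N_k(G)$ denotes the number of irreducible complex characters $\chi$ of $G$ with $\chi(1)=k$. *)

(* Defs.v *)
From HB Require Import structures.
From mathcomp Require Import all_boot all_order all_algebra all_fingroup.
From mathcomp Require Import all_field all_character.

Set Implicit Arguments.
Unset Strict Implicit.
Unset Printing Implicit Defensive.

Import Order.TTheory GRing.Theory Num.Theory.

Local Open Scope ring_scope.

(* The ambient type {'GL_n[F]} consists of the invertible matrices of size
   n.-1.+1, which is n as soon as n > 0 (for n = 0 it is 1, so that
   unitriangular 0 F is trivial). *)
Definition unitriangular (n : nat) (F : finFieldType) : {set {'GL_n[F]}} :=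
  [set g : {'GL_n[F]} |
    [forall i : 'I_n.-1.+1, forall j : 'I_n.-1.+1,
      (j <= i)%N ==> (GLval g i j == (i == j)%:R)]].

Lemma unitriangularP n (F : finFieldType) (g : {'GL_n[F]}) :
  reflect (forall i j : 'I_n.-1.+1, (j <= i)%N -> GLval g i j = (i == j)%:R)
          (g \in unitriangular n F).
Proof.
rewrite inE; apply: (iffP forallP) => [h i j le_ji|h i].
  by move/forallP: (h i) => /(_ j)/implyP/(_ le_ji)/eqP.
by apply/forallP=> j; apply/implyP=> le_ji; apply/eqP/h.
Qed.

Lemma unitriangular_group_set n (F : finFieldType) : 
  group_set (unitriangular n F).
Proof.
apply/group_setP; split=> [|g h /unitriangularP gU /unitriangularP hU].
  by apply/unitriangularP=> i j _; rewrite GL_1E mxE.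
apply/unitriangularP=> i j le_ji; rewrite GL_ME mxE (bigD1 i) //= big1 ?addr0.
  by rewrite gU // eqxx mul1r hU.
move=> k ne_ki; case: (ltngtP k i) => [lt_ki|lt_ik|/val_inj eq_ki].
- by rewrite gU 1?ltnW // eq_sym (negPf ne_ki) mul0r.
- rewrite hU ?(leq_trans le_ji) 1?ltnW //.
  by rewrite -val_eqE /= gtn_eqF ?mulr0 // (leq_ltn_trans le_ji).
- by rewrite eq_ki eqxx in ne_ki.
Qed.

Canonical unitriangular_group n (F : finFieldType) :=
  Group (unitriangular_group_set n F).

Notation "''U_' n [ F ]" := (unitriangular_group n F)
  (at level 8, n at level 2, format "''U_' n [ F ]").

(* Irr G consists of algC-valued characters; character values of finite groups
   are algebraic, so these are the irreducible complex characters. *)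
Definition num_irr_deg (gT : finGroupType) (G : {group gT}) (k : nat) : nat :=
  #|[set i : Iirr G | 'chi_i 1%g == k%:R]|.

Definition prime_power (q : nat) : Prop :=
  exists p k : nat, [/\ prime p, (0 < k)%N & q = (p ^ k)%N].

(* rat rather than int: the formulas have denominators 2, 4, 6 and 12, and
   that their values are integers is part of the theorem. *)
Definition A_coef (n : rat) : rat := n - 7.
Definition B_coef (n : rat) : rat := 3 + (n - 7) * (n - 6).
Definition C_coef (n : rat) : rat :=
  40 * (n - 7) - 17 / 4 * (n + 8) * (n - 7)
    + 1 / 12 * n * (n + 1) * (2 * n + 1) - 64.
Definition D_coef (n : rat) : rat :=
  (n - 7) * (7 * n + 3) - 1 / 6 * n * (n + 1) * (2 * n + 1) + 138.
Definition E_coef (n : rat) : rat :=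
  (n - 7) * (- (17 / 4) * n - 1) + 1 / 12 * n * (n + 1) * (2 * n + 1) - 75.
Definition F_coef (n : rat) : rat := 1 + (n - 7) * (n - 4) / 2.

(* Main.v *)
Require Import Defs.
From HB Require Import structures.
From mathcomp Require Import all_boot all_order all_algebra all_fingroup.
From mathcomp Require Import all_field all_character.
From mathcomp Require Import zify ring.

Set Implicit Arguments.
Unset Strict Implicit.
Unset Printing Implicit Defensive.

Import Order.TTheory GRing.Theory Num.Theory.

Local Open Scope ring_scope.

(* Expand along the first row. In a pattern group G (entries allowed only at a
   transitive set D of positions above the diagonal) the entries of the first
   row form an abelian normal subgroup V with a complement H, which is the
   pattern group of the remaining rows. A nontrivial additive character of F
   identifies Irr(V) with the column vectors x supported on the columns of the
   row, and by Clifford and Gallagher the irreducible characters of G over x are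
   those of the stabilizer of x in H, with degrees multiplied by its index. If
   the columns of the row are totally ordered by D, a nonzero x with last
   nonzero entry c at position k lies in the H-orbit of c e_k, whose stabilizer
   is again a pattern group: the positions of column k above k are removed.
   From U_n and degree q^3, only a few patterns are reached in this way, and
   their numbers of characters of small degree satisfy recursions in the size
   that can be solved. All of this is independent of the characteristic. *)

(** * Little groups for an abelian normal subgroup *)

Lemma card_irr_isog (aT rT : finGroupType) (G : {group aT})
    (R : {group rT}) (P : pred algC) :
  G \isog R ->
  #|[set i : Iirr G | P ('chi_i 1%g)]| = #|[set i : Iirr R | P ('chi_i 1%g)]|.
Proof.
case/isogP=> f injf defR.
have isoGR: isom G R f by apply/isomP.
rewrite -(card_imset _ (isom_Iirr_inj isoGR)); apply: eq_card => j.
apply/imsetP/idP => [[i] | ]; rewrite !inE.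
  by move=> Pi ->; rewrite isom_IirrE cfIsom1.
move=> Pj; exists (isom_Iirr (isom_sym isoGR) j); last by rewrite isom_IirrKV.
by rewrite inE isom_IirrE cfIsom1.
Qed.

Lemma linear_irr_of_fun (gT : finGroupType) (G : {group gT}) (f : gT -> algC) :
  f 1%g = 1 -> {in G &, forall x y, f (x * y)%g = f x * f y} ->
  exists c : Iirr G, {in G, 'chi_c =1 f}.
Proof.
move=> f1 fM; pose r g : 'M[algC]_1 := (f g)%:M.
have r_repr : mx_repr G r.
  by split=> [|x y Gx Gy]; rewrite /r ?f1 // -scalar_mxM fM.
pose rG := MxRepresentation r_repr.
have lin_r : cfRepr rG \is a linear_char.
  by rewrite qualifE/= cfRepr_char cfRepr1 eqxx.
have /irrP[c Dc] := lin_char_irr lin_r.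
exists c => x Gx; rewrite -Dc cfunE Gx mulr1n mxtrace_scalar.
by rewrite mulr1n.
Qed.

(** The extension sends v s to [lam] v for v in [V] and s in [S]; it is multiplicative because [S]
    fixes [lam]. *)
Lemma extend_linear_sdprod (gT : finGroupType) (T V S : {group gT})
    (lam : 'CF(V)) :
  (V ><| S = T)%g -> lam \is a linear_char -> S \subset inertia lam ->
  exists c : Iirr T, 'Res[V] 'chi_c = lam.
Proof.
move=> defT linV invl.
have [nVT sST mulVS nVS tiVS] := sdprod_context defT.
have VSP z : z \in T -> divgr V S z \in V /\ remgr V S z \in S.
  by rewrite -mulVS => VSz; rewrite mem_divgr ?mem_remgr.
have [||c Dc] := @linear_irr_of_fun _ T (fun g => lam (divgr V S g)).
- by rewrite divgr_id ?lin_char1.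
- move=> x y Tx Ty; have [Vdx Srx] := VSP x Tx; have [Vdy Sry] := VSP y Ty.
  rewrite {1}(divgr_eq V S x) {1}(divgr_eq V S y).
  set u := divgr V S x; set v := divgr V S y.
  set s := remgr V S x; set t := remgr V S y.
  have ->: (u * s * (v * t) = u * v ^ s^-1 * (s * t))%g.
    by move: u v s t => u v s t; rewrite conjgE invgK !mulgA mulgKV.
  have Vvs : (v ^ s^-1)%g \in V by rewrite memJ_norm ?groupV ?(subsetP nVS).
  have Is : (s^-1)%g \in inertia lam by rewrite groupV (subsetP invl).
  rewrite (divgrMid tiVS) ?(groupM Srx Sry) //; last exact: (groupM Vdx Vvs).
  by rewrite (lin_charM linV Vdx Vvs) (inertia_valJ v Is).
exists c; apply/cfun_inP=> x Vx; have Tx := subsetP (normal_sub nVT) x Vx.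
by rewrite cfResE ?normal_sub // Dc // divgr_id.
Qed.

Section LittleGroups.

Variables (gT : finGroupType) (G V H : {group gT}).
Hypotheses (defG : (V ><| H = G)%g) (abV : abelian V).

Definition irr_over (i : Iirr V) (P : pred algC) : {set Iirr G} :=
  [set j | (i \in irr_constt ('Res[V] 'chi_j)) && P ('chi_j 1%g)].

(** Clifford and Gallagher combined: ['chi_i] extends to a linear character [c] of its inertia group
    [T], the characters of [T] over ['chi_i] are the products of [c] with inflations from T/V, which
    is isomorphic to [S], and induction to [G] multiplies degrees by |G : T| = |H : S|. *)
Lemma card_irr_over (i : Iirr V) (P : pred algC) :
  #|irr_over i P| =
  #|[set j : Iirr (H :&: inertia 'chi_i)%G |
      P (#|H : (H :&: inertia 'chi_i)%G|%g%:R * 'chi_j 1%g)]|.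
Proof.
have [nVG sHG mulVH nVH tiVH] := sdprod_context defG.
set S := (H :&: inertia 'chi_i)%G; pose T := (G :&: inertia 'chi_i)%G.
have sVG := normal_sub nVG.
have defT : (V ><| S = T)%g by apply: sdprod_modl => //; exact: sub_inertia.
have [nVT sST mulVS nVS tiVS] := sdprod_context defT.
have linV : 'chi_i \is a linear_char by apply/char_abelianP.
have [c Dc] := extend_linear_sdprod defT linV (subsetIr _ _).
have [irrM injM consM _] := constt_Ind_ext nVT Dc.
have [irrI injI imI _ _] := constt_Inertia_bijection i nVG.
have linc : 'chi_c 1%g = 1.
  by rewrite -(cfRes1 V) Dc lin_char1.
have indexE : #|G : T|%g = #|H : S|%g.
  apply/eqP; rewrite -(eqn_pmul2l (cardG_gt0 T)) Lagrange ?subsetIl //.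
  rewrite -(sdprod_card defG) -(sdprod_card defT) -mulnA Lagrange ?subsetIl //.
have isoST : S \isog (T / V)%g := sdprod_isog defT.
rewrite (card_irr_isog (fun x => P (#|H : S|%g%:R * x)) isoST).
pose f (b : Iirr (T / V)) : Iirr G := Ind_Iirr G (mul_mod_Iirr c b).
have inA (b : Iirr (T / V)) : mul_mod_Iirr c b \in irr_constt ('Ind[T] 'chi_i).
  by rewrite consM codom_f.
have injf : injective f by move=> b1 b2 /injI-/(_ (inA _) (inA _))/injM.
rewrite -(card_imset _ injf); apply: eq_card => j.
have f1 b : 'chi_(f b) 1%g = #|H : S|%g%:R * 'chi_b 1%g.
  rewrite /f cfIirrE; last exact: irrI.
  rewrite cfInd1 ?subsetIl // indexE cfIirrE ?irrM // cfunE linc mulr1.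
  by rewrite mod_IirrE // cfMod1.
apply/idP/imsetP.
  rewrite inE -constt_Ind_Res -imI => /andP[/imsetP[s]].
  rewrite consM => /codomP[b ->] -> Pb.
  by exists b => //; rewrite inE -f1.
case=> b; rewrite inE => Pb ->; rewrite inE f1 Pb andbT.
by rewrite -constt_Ind_Res -imI; apply/imsetP; exists (mul_mod_Iirr c b).
Qed.

Lemma irr_over_conj i y P : y \in G ->
  irr_over (conjg_Iirr i y) P = irr_over i P.
Proof.
move=> Gy; apply/setP=> j.
by rewrite [LHS]inE [RHS]inE !irr_consttE conjg_IirrE cfdot_Res_conjg.
Qed.

(** By Clifford's theorem each character of [G] lies over exactly one orbit in Irr(V). Weighting the
    members of an orbit by the inverse of its size counts the character once, with no choice of
    representatives. *)
Lemma sum_irr_over P :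
  (#|[set j : Iirr G | P ('chi_j 1%g)]|%:R : rat) =
  \sum_(i : Iirr V) #|irr_over i P|%:R / #|H : (H :&: inertia 'chi_i)%G|%g%:R.
Proof.
have [nVG sHG mulVH nVH tiVH] := sdprod_context defG.
pose orb i : {set Iirr V} := cfclass_Iirr G i.
(* [V] lies in every inertia group, so the size of a [G]-orbit is an index in [H]. *)
have orbE i : #|orb i| = #|H : (H :&: inertia 'chi_i)%G|%g.
  rewrite /orb card_cfclass_Iirr //.
  apply/eqP; rewrite -(eqn_pmul2l (cardG_gt0 (G :&: inertia 'chi_i)%G)).
  rewrite Lagrange ?subsetIl // -(sdprod_card defG).
  have := sdprod_modl defG (sub_inertia 'chi_i) => /(@sdprod_card _ _ _ _) <-.
  by rewrite -mulnA Lagrange ?subsetIl.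
under [RHS]eq_bigr => i _ do rewrite -orbE -sum1_card natr_sum mulr_suml.
rewrite (exchange_big_dep (fun j : Iirr G => P ('chi_j 1%g))) /=; last first.
  by move=> i j _; rewrite inE => /andP[].
rewrite -sum1_card natr_sum; apply: eq_big => [j | j]; first by rewrite inE.
rewrite inE => Pj.
have /neq0_has_constt[i0 i0j] : 'Res[V] 'chi_j != 0.
  by rewrite -char1_eq0 ?cfRes_char ?irr_char // cfRes1 irr1_neq0.
have overE i : (j \in irr_over i P) = (i \in orb i0).
  rewrite inE Pj andbT irr_consttE.
  rewrite (Clifford_Res_sum_cfclass nVG i0j) cfdotZl mulf_eq0 negb_or.
  rewrite -irr_consttE i0j /= reindex_cfclass // cfdot_suml.
  rewrite /orb cfclass_IirrE.
  have [i0i|Ni0i] := boolP ('chi_i \in _).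
    rewrite (bigD1 i) //= cfnorm_irr big1 ?addr0 ?oner_eq0 // => k /andP[_ ki].
    by rewrite cfdot_irr (negPf ki).
  rewrite big1 ?eqxx // => k Hk; rewrite cfdot_irr; case: eqP => // ki.
  by rewrite -ki Hk in Ni0i.
rewrite (eq_bigl _ _ overE) (eq_bigr (fun _ => (#|orb i0|%:R)^-1)); last first.
  by move=> i; rewrite /orb -eq_cfclass_IirrE mul1r => /eqP->.
rewrite sumr_const -[RHS]mulr_natl divff // pnatr_eq0 -lt0n.
by apply/card_gt0P; exists i0; rewrite /orb cfclass_IirrE cfclass_refl.
Qed.

End LittleGroups.

(** * Pattern groups *)

Lemma GL_inj n (F : finFieldType) (g h : {'GL_n[F]}) :
  (forall i j, GLval g i j = GLval h i j) -> g = h.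
Proof. by move=> eq_gh; apply/val_inj/matrixP. Qed.

Definition closed_pattern (D : rel nat) :=
  (forall i j, D i j -> (i < j)%N) /\ transitive D.

Section PatternGroups.

Variables (n : nat) (F : finFieldType).
Local Notation m := n.-1.+1.
Local Notation gT := {'GL_n[F]}.
Implicit Types (D : rel nat) (g h : gT).

Definition pattern_set D : {set gT} :=
  [set g : gT | [forall i : 'I_m, forall j : 'I_m,
     ~~ D i j ==> (GLval g i j == (i == j)%:R)]].

(* The generated group is pattern_set D itself when D is a closed pattern. *)
Definition pattern_group D := <<pattern_set D>>%G.

Lemma pattern_setP D g :
  reflect (forall i j : 'I_m, ~~ D i j -> GLval g i j = (i == j)%:R)
          (g \in pattern_set D).
Proof.
rewrite inE; apply: (iffP forallP) => [h i j Dij|h i].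
  by move/forallP: (h i) => /(_ j)/implyP/(_ Dij)/eqP.
by apply/forallP=> j; apply/implyP=> Dij; apply/eqP/h.
Qed.

Lemma mem_pattern_group D : closed_pattern D ->
  pattern_group D =i pattern_set D.
Proof.
case=> ltD trD; have gD : group_set (pattern_set D).
  apply/group_setP; split=> [|g h /pattern_setP gU /pattern_setP hU].
    by apply/pattern_setP=> i j _; rewrite GL_1E mxE.
  have nD (i : 'I_m) : ~~ D i i by apply/negP=> /ltD; rewrite ltnn.
  apply/pattern_setP=> i j nDij; rewrite GL_ME mxE (bigD1 i) //= big1.
    by rewrite addr0 gU // eqxx mul1r hU.
  move=> k ne_ki; have [Dik|nDik] := boolP (D i k).
    rewrite (hU k) ?(contra (trD _ _ _ Dik)) //.
    have [kj|_] := eqVneq k j; last by rewrite mulr0.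
    by rewrite -kj Dik in nDij.
  by rewrite gU // eq_sym (negPf ne_ki) mul0r.
by move=> g; rewrite -[pattern_set D]/(gval (Group gD)) -[in RHS]genGid.
Qed.

Lemma pattern_groupP D g : closed_pattern D ->
  reflect (forall i j : 'I_m, ~~ D i j -> GLval g i j = (i == j)%:R)
          (g \in pattern_group D).
Proof. by move=> cD; rewrite mem_pattern_group //; apply: pattern_setP. Qed.

Lemma eq_pattern_group D D' :
  (forall i j : nat, (i < m)%N -> (j < m)%N -> D i j = D' i j) ->
  pattern_group D = pattern_group D'.
Proof.
move=> eqD; congr <<_>>%G; apply/setP=> g; rewrite !inE.
by apply: eq_forallb => i; apply: eq_forallb => j; rewrite eqD.
Qed.

(** Such a matrix is triangular with unit diagonal, hence invertible. Elements of pattern groups are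
    constructed from their entries in this way. *)
Lemma pattern_mx D (A : 'M[F]_m) : closed_pattern D ->
  (forall i j : 'I_m, ~~ D i j -> A i j = (i == j)%:R) ->
  exists2 g, g \in pattern_group D & GLval g = A.
Proof.
move=> cD hA; have [ltD _] := cD.
have uA : A \in unitmx.
  rewrite unitmxE -det_tr det_trig.
    by rewrite big1 ?unitr1 // => i _; rewrite mxE hA ?eqxx //;
      apply/negP=> /ltD; rewrite ltnn.
  apply/is_trig_mxP=> i j ij; rewrite mxE hA ?gt_eqF //.
  by apply/negP=> /ltD ji; have := ltn_trans ij ji; rewrite ltnn.
exists (FinRing.unit _ uA : gT) => //.
by apply/(pattern_groupP _ cD).
Qed.

(** The map g |-> g - 1 is a bijection onto the functions supported on [D]. *)
Lemma card_pattern_group D : closed_pattern D ->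
  #|pattern_group D| = (#|F| ^ #|[pred p : 'I_m * 'I_m | D p.1 p.2]|)%N.
Proof.
move=> cD; rewrite -[#|F|]/(#|(predT : {pred F})|) -(card_pffun_on (0 : F)).
pose f g : {ffun 'I_m * 'I_m -> F} :=
  [ffun p => GLval g p.1 p.2 - (p.1 == p.2)%:R].
have injf : injective f.
  move=> g h /ffunP eqf; apply/val_inj/matrixP=> i j.
  by have := eqf (i, j); rewrite !ffunE /= => /addIr.
rewrite -(card_imset _ injf); apply: eq_card => x.
apply/imsetP/pffun_onP => [[g Gg ->]|[suppx _]].
  split=> //; apply/supportP=> -[i j]; rewrite inE /= => nDij.
  by rewrite ffunE /= (pattern_groupP _ cD _) // subrr.
have [i j nDij|g Gg Dg] :=
  @pattern_mx D (\matrix_(i, j) (x (i, j) + (i == j)%:R)) cD.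
  by rewrite mxE (supportP suppx) ?add0r.
exists g => //; apply/ffunP=> -[i j]; rewrite ffunE /= Dg mxE /=.
by rewrite addrK.
Qed.

End PatternGroups.

(** * Expansion along a row *)

(** The additive group of [F] is abelian of order greater than 1, so it has a nonprincipal
    irreducible character, and this character is linear. *)
Lemma nontrivial_additive_char (F : finFieldType) :
  exists psi : F -> algC, [/\ psi 0 = 1, forall a b, psi (a + b) = psi a * psi b
    & exists a, psi a != 1].
Proof.
pose G := [set: F]%G.
have abG : abelian G by apply/centsP=> x _ y _; apply: addrC.
have : (1 < #|Iirr G|)%N by rewrite card_Iirr_abelian // cardsT finNzRing_gt1.
rewrite (cardD1 0) inE ltnS => /card_gt0P[i /andP[i0 _]].
have lini : 'chi_i \is a linear_char by apply/char_abelianP.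
exists 'chi_i; split=> [|a b|].
- exact: lin_char1 lini.
- by apply: (lin_charM lini); rewrite inE.
apply/existsP; apply: contraR i0; rewrite negb_exists => /forallP chi1.
apply/eqP/irr_inj; rewrite irr0; apply/cfunP=> a; rewrite cfun1E inE.
by apply/eqP; have := chi1 a; rewrite negbK.
Qed.

Definition row_pattern (D : rel nat) (r : nat) : rel nat :=
  fun i j => (i == r) && D i j.

Definition minus_row (D : rel nat) (r : nat) : rel nat :=
  fun i j => (i != r) && D i j.

Lemma closed_row_pattern D r :
  closed_pattern D -> closed_pattern (row_pattern D r).
Proof.
case=> ltD trD; split=> [i j /andP[_ /ltD] //|y x z].
by case/andP=> xr Dxy /andP[yr Dyz]; rewrite /row_pattern xr (trD y).
Qed.

Lemma closed_minus_row D r : closed_pattern D -> closed_pattern (minus_row D r).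
Proof.
case=> ltD trD; split=> [i j /andP[_ /ltD] //|y x z].
by case/andP=> xr Dxy /andP[yr Dyz]; rewrite /minus_row xr (trD y).
Qed.

Section RowReduction.

Variables (n : nat) (F : finFieldType) (D : rel nat).
Local Notation m := n.-1.+1.
Local Notation gT := {'GL_n[F]}.
Local Notation vec := {ffun 'I_m -> F}.
Variable r : 'I_m.
Hypotheses (cD : closed_pattern D) (Dr : forall i, ~~ D i r).

Let G := pattern_group n F D.
Let V := pattern_group n F (row_pattern D r).
Let H := pattern_group n F (minus_row D r).
Let cV := closed_row_pattern r cD.
Let cH := closed_minus_row r cD.

Let inV (v : gT) : v \in V ->
  forall i j, GLval v i j =
    if (i == r) && D r j then GLval v r j else (i == j)%:R.
Proof.
move=> /(pattern_groupP _ cV) hv i j; case: ifP => [/andP[/eqP-> _]//|Nij].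
by apply: hv; apply: contraFN Nij => /andP[/eqP/val_inj-> ->]; rewrite eqxx.
Qed.

Let inHr (h : gT) : h \in H -> forall j, GLval h r j = (r == j)%:R.
Proof.
by move=> /(pattern_groupP _ cH) hh j; apply: hh; rewrite /minus_row eqxx.
Qed.

Let inHc (h : gT) : h \in H -> forall i, GLval h i r = (i == r)%:R.
Proof.
by move=> /(pattern_groupP _ cH) hh j; apply: hh; rewrite negb_and Dr orbT.
Qed.

Let inVr (v : gT) (j : 'I_m) : v \in V -> ~~ D r j -> GLval v r j = (r == j)%:R.
Proof. by move=> Vv Drj; rewrite inV // (negPf Drj) andbF. Qed.

Let neq_r (j : 'I_m) : D r j -> (r == j) = false.
Proof. by have [ltD _] := cD; case: eqP => // <- /ltD; rewrite ltnn. Qed.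

Let mulV (v w : gT) (j : 'I_m) : v \in V -> w \in V -> D r j ->
  GLval (v * w) r j = GLval v r j + GLval w r j.
Proof.
move=> Vv Vw Drj; rewrite GL_ME mxE (bigD1 r) //= (bigD1 j) /=; last first.
  by rewrite eq_sym neq_r.
rewrite big1 ?addr0 => [|k /andP[kr kj]].
  rewrite (inVr Vv) // eqxx mul1r [GLval w j j]inV // [j == r]eq_sym neq_r //.
  by rewrite eqxx mulr1 addrC.
by rewrite (inV Vw) (negPf kr) (negPf kj) mulr0.
Qed.

Let abV : abelian V.
Proof.
apply/centsP=> v Vv w Vw; apply: GL_inj => i j.
have Vvw := groupM Vv Vw; have Vwv := groupM Vw Vv.
rewrite [LHS](inV Vvw) [RHS](inV Vwv); case: ifP => // /andP[_ Drj].
by rewrite !mulV // addrC.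
Qed.

(** Row and column [r] of [h] are trivial, so conjugation by [h] multiplies row [r] of [v] by [h]
    and leaves the other rows alone. *)
Let conjV (v h : gT) : v \in V -> h \in H ->
  (v ^ h)%g \in V /\
  forall j : 'I_m, D r j ->
    GLval (v ^ h)%g r j = \sum_(k : 'I_m | D r k) GLval v r k * GLval h k j.
Proof.
move=> Vv Hh; have [ltD trD] := cD.
pose A : 'M[F]_m := \matrix_(i, j) if (i == r) && D r j
  then \sum_(k : 'I_m | D r k) GLval v r k * GLval h k j else (i == j)%:R.
have [i j|w Vw Dw] := @pattern_mx n F _ A cV.
  rewrite mxE; case: ifP => // /andP[/eqP-> Drj].
  by rewrite /row_pattern eqxx Drj.
suff -> : (v ^ h = w)%g.
  by split=> // j Drj; rewrite Dw mxE eqxx Drj.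
(* The claim is checked as v h = h w, which avoids the entries of the inverse of [h]. *)
rewrite conjgE; apply: (canLR (mulKg h)); apply: GL_inj => i j.
rewrite !GL_ME !mxE.
have [-> {i}|ir] := eqVneq i r.
  rewrite [RHS](bigD1 r) //= [X in _ + X]big1 ?addr0 => [|k kr]; last first.
    by rewrite (inHr Hh) eq_sym (negPf kr) mul0r.
  rewrite (inHr Hh) eqxx mul1r Dw mxE eqxx /=.
  case: ifP => [Drj|/negbT nDrj].
    rewrite (bigID (fun k : 'I_m => D r k)) /= [X in _ + X]big1 ?addr0 // =>
      k nDrk.
    rewrite (inVr Vv) //; case: eqP => [<-|_]; last by rewrite mul0r.
    by rewrite (inHr Hh) neq_r // mulr0.
  rewrite (bigD1 r) //= (inVr Vv) // eqxx mul1r (inHr Hh) big1 ?addr0 // =>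
    k kr.
  have [Drk|nDrk] := boolP (D r k); last first.
    by rewrite (inVr Vv) // eq_sym (negPf kr) mul0r.
  rewrite (pattern_groupP _ cH Hh); last first.
    by rewrite negb_and (contra (trD _ _ _ Drk)) ?orbT.
  by case: eqP => [kj|_]; rewrite ?mulr0 // -kj Drk in nDrj *.
rewrite (bigD1 i) //= (inV Vv) (negPf ir) eqxx mul1r.
rewrite big1 ?addr0 => [|k ki]; last first.
  by rewrite (inV Vv) (negPf ir) eq_sym (negPf ki) mul0r.
rewrite (bigD1 j) //= Dw mxE.
case: ifP => [/andP[/eqP jr Drj]|_].
  by have := neq_r Drj; rewrite jr eqxx.
rewrite eqxx mulr1 big1 ?addr0 // => k kj; rewrite mxE.
case: ifP => [/andP[/eqP-> _]|_]; last by rewrite (negPf kj) mulr0.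
by rewrite (inHc Hh) (negPf ir) mul0r.
Qed.

Let defG : (V ><| H = G)%g.
Proof.
have nVH : H \subset 'N(V)%g.
  apply/subsetP=> h Hh; rewrite inE; apply/subsetP=> _ /imsetP[v Vv ->].
  by have [] := conjV Vv Hh.
have e1 i j : GLval (1%g : gT) i j = (i == j)%:R by rewrite GL_1E mxE.
have tiVH : V :&: H = 1%g.
  apply/trivgP/subsetP=> g /setIP[Vg Hg]; rewrite inE;
    apply/eqP/val_inj/matrixP=> i j.
  rewrite [LHS](inV Vg); case: ifP => [/andP[/eqP-> _]|_].
    by rewrite (inHr Hg).
  by [].
(* Both factors lie in [G], so comparing orders is enough: the positions of [D] split into those in
   row [r] and the others. *)
rewrite sdprodE //; apply/eqP; rewrite eqEcard mul_subG /=; first last.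
- apply/subsetP=> h /(pattern_groupP _ cH) hh; apply/(pattern_groupP _ cD).
  by move=> i j nDij; apply: hh; rewrite negb_and nDij orbT.
- apply/subsetP=> h /(pattern_groupP _ cV) hh; apply/(pattern_groupP _ cD).
  by move=> i j nDij; apply: hh; rewrite negb_and nDij orbT.
rewrite TI_cardMg // !card_pattern_group // -expnD leq_pexp2l ?(ltnW
  (finNzRing_gt1 F)) //.
rewrite -(cardID [pred p : 'I_m * 'I_m | p.1 == r]) leq_add // subset_leq_card //.
  by apply/subsetP=> p; rewrite !inE /row_pattern andbC.
Qed.

(* x stands for the linear character v |-> psi (\sum_j v r j * x j) of V, where
   psi is a fixed nontrivial additive character of F. *)
Definition col_action (h : gT) (x : vec) : vec :=
  [ffun k : 'I_m => if D r k then \sum_j GLval h k j * x j else 0].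

Definition row_dual : {set vec} :=
  [set x : vec | [forall k : 'I_m, ~~ D r k ==> (x k == 0)]].

Lemma row_dualP (x : vec) :
  reflect (forall k : 'I_m, ~~ D r k -> x k = 0) (x \in row_dual).
Proof.
rewrite inE; apply: (iffP forallP) => [h k Dk|h k].
  by apply/eqP; move/implyP: (h k); apply.
by apply/implyP=> Dk; rewrite h.
Qed.

(** Since the abelian group [V] has |V| irreducible characters, this turns an injection from
    [row_dual] to Irr(V) into a bijection. *)
Lemma card_row_dual : #|row_dual| = #|V|.
Proof.
have [ltD _] := cD.
transitivity #|pffun_on (0 : F) [pred k : 'I_m | D r k] (predT : {pred F})|.
  apply: eq_card => x; apply/row_dualP/pffun_onP => [hx|[/supportP hx _]].
    by split=> //; apply/supportP=> k; rewrite inE; apply: hx.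
  by move=> k Dk; apply: hx; rewrite inE.
rewrite card_pffun_on card_pattern_group //; congr (_ ^ _)%N.
have injf : injective (fun k : 'I_m => (r, k)) by move=> k k' [].
rewrite -(card_image injf); apply: eq_card => -[i j].
apply/imageP/idP; rewrite inE /=.
  by case=> k; rewrite inE => Dk [-> ->]; rewrite /row_pattern eqxx.
by case/andP=> /eqP/val_inj-> Dj; exists j.
Qed.

(* w x is the number of characters of G above x, divided by the size of the
   H-orbit of x. *)
Lemma row_reduction (P : pred algC) :
  exists w : vec -> rat,
  [/\ (#|[set j : Iirr G | P ('chi_j 1%g)]|%:R : rat)
        = \sum_(x in row_dual) w x,
      {in row_dual & H, forall x h, w (col_action h x) = w x}
    & {in row_dual, forall x, exists2 S : {group gT},
        S :=: [set h in H | col_action h x == x] &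
        w x = #|[set j : Iirr S | P (#|H : S|%g%:R * 'chi_j 1%g)]|%:R
              / #|H : S|%g%:R}].
Proof.
have [ltD trD] := cD.
have [nVG sHG mulVH nVH tiVH] := sdprod_context defG.
have [psi [psi0 psiD [a psia]]] := nontrivial_additive_char F.
pose lam (x : vec) (v : gT) := psi (\sum_(j : 'I_m | D r j) GLval v r j * x j).
have exL x : exists i : Iirr V, {in V, 'chi_i =1 lam x}.
  apply: linear_irr_of_fun.
    rewrite /lam big1 ?psi0 // => j Drj.
    by rewrite GL_1E mxE neq_r // mul0r.
  move=> v w Vv Vw; rewrite /lam -psiD -big_split /=; congr psi.
  by apply: eq_bigr => j Drj; rewrite mulV // mulrDl.
have [L LE] := fin_all_exists exL.
have injL : {in row_dual &, injective L}.
  move=> x y /row_dualP hx /row_dualP hy eqL; apply/ffunP=> j.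
  have [Drj|nDrj] := boolP (D r j); last by rewrite hx ?hy.
  apply: contraNeq psia; rewrite -subr_eq0 => nz.
  (* If x and y differ at [j], their characters are separated by the element of [V] with the single
     entry a / (x j - y j) in column [j]: equal values there would force [psi a] = 1. *)
  pose A b : 'M[F]_m := \matrix_(i, k) if (i == r) && (k == j) then b
    else (i == k)%:R.
  have [b|v Vv Dv] := @pattern_mx n F _ (A (a / (x j - y j))) cV.
    move=> k; rewrite mxE; case: ifP => // /andP[/eqP-> /eqP->].
    by rewrite /row_pattern eqxx Drj.
  have lamE z : lam z v = psi (a / (x j - y j) * z j).
    rewrite /lam (bigD1 j) //= Dv mxE !eqxx big1 ?addr0 // => k /andP[Drk kj].
    by rewrite mxE eqxx (negPf kj) neq_r ?mul0r.
  have : lam x v = lam y v by rewrite -!LE // eqL.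
  rewrite !lamE -[X in psi (_ * X) = _](subrK (y j)) mulrDr psiD.
  rewrite divfK // => /eqP; rewrite -subr_eq0 -{2}[psi (_ * y j)]mul1r -mulrBl.
  rewrite mulf_eq0 subr_eq0 => /orP[//|/eqP psiy0].
  (* [psi] has no zero, because psi(u) psi(-u) = psi(0) = 1. *)
  have := psiD (a / (x j - y j) * y j) (- (a / (x j - y j) * y j)).
  by rewrite psiy0 mul0r subrr psi0 => /eqP; rewrite oner_eq0.
have L_act x h : h \in H -> conjg_Iirr (L x) h^-1%g = L (col_action h x).
  move=> Hh; apply: irr_inj; rewrite conjg_IirrE; apply/cfun_inP=> v Vv.
  have [Vvh vhE] := conjV Vv Hh.
  rewrite cfConjgE ?invgK ?groupV ?(subsetP nVH) // !LE // /lam; congr psi.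
  under eq_bigr => j Drj do rewrite vhE // mulr_suml.
  rewrite exchange_big /=; apply: eq_bigr => k Drk.
  rewrite ffunE Drk mulr_sumr [RHS](bigID (fun j : 'I_m => D r j)) /=.
  rewrite [X in _ = _ + X]big1 ?addr0 => [|j nDrj]; last first.
    rewrite (pattern_groupP _ cH Hh); last first.
      by rewrite negb_and (contra (trD _ _ _ Drk)) ?orbT.
    by case: eqP => [kj|_]; rewrite ?mul0r ?mulr0 // -kj Drk in nDrj *.
  by apply: eq_bigr => j _; rewrite mulrA.
pose I x := (H :&: inertia 'chi_(L x))%G.
exists (fun x => #|irr_over G (L x) P|%:R / #|H : I x|%g%:R); split.
- rewrite (sum_irr_over defG).
  have imL : L @: row_dual = setT.
    apply/eqP; rewrite eqEcard subsetT card_in_imset // cardsT.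
    by rewrite card_row_dual -(card_Iirr_abelian abV); apply: leqnn.
  rewrite -[RHS](big_imset (fun i => #|irr_over G i P|%:R
    / #|H : (H :&: inertia 'chi_i)%G|%g%:R) injL) imL.
  by apply: eq_bigl => i; rewrite inE.
- move=> x h _ Hh; rewrite -L_act //.
  have HV : (h^-1)%g \in 'N(V)%g by rewrite groupV (subsetP nVH).
  rewrite irr_over_conj ?groupV ?(subsetP sHG) //; congr (_ / _%:R).
  rewrite -!divgS ?subsetIl //; congr (_ %/ _)%N.
  rewrite /I /= -L_act // conjg_IirrE -(conjg_inertia _ HV).
  by rewrite -{1}(conjGid (groupVr Hh)) -conjIg cardJg.
move=> x /row_dualP hx; exists (I x).
  (* Through [L], [h] acts as conjugation by its inverse, so membership in the inertia group is
     tested on the inverse of [h]. *)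
  apply/esym/setP=> h; rewrite /=; rewrite !in_setI inE.
  apply: andb_id2l => Hh; rewrite -groupV inE groupV (subsetP nVH) //=.
  rewrite -conjg_IirrE (inj_eq irr_inj) L_act //.
  apply/eqP/eqP=> [-> //|/injL->//]; last exact/row_dualP.
  by apply/row_dualP=> k nDrk; rewrite ffunE (negPf nDrk).
by rewrite (card_irr_over defG abV).
Qed.

End RowReduction.

(** * Numbers of characters under the expansion of a row *)

(** The pattern of the stabilizer in [H] of c e_k with c nonzero: only rows [i] with [D r i] act on
    the coordinates, and their entries above the diagonal in column [k] must vanish. *)
Definition minus_col (D : rel nat) (r k : nat) : rel nat :=
  fun i j => minus_row D r i j && ~~ (D r i && (j == k)).

(** If (x, y) and (y, k) are positions and x is a column of row [r], then so is y by transitivity of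
    [D]; hence (y, k) was removed together with (x, k). *)
Lemma closed_minus_col D r k :
  closed_pattern D -> closed_pattern (minus_col D r k).
Proof.
move=> cD; have [ltD trD] := closed_minus_row r cD.
split=> [i j /andP[/ltD]//|y x z /andP[xy nxy] /andP[yz nyz]].
rewrite /minus_col (trD y) //=; apply: contra nyz => /andP[Drx ->].
by case/andP: xy => _ Dxy; rewrite andbT (cD.2 _ _ _ Drx).
Qed.

Lemma irr_deg_mul (gT : finGroupType) (S : {group gT}) (q c e : nat) :
  (1 < q)%N ->
  #|[set j : Iirr S | (q ^ c)%:R * 'chi_j 1%g == (q ^ e)%:R]| =
  if (c <= e)%N then num_irr_deg S (q ^ (e - c)) else 0%N.
Proof.
move=> q_gt1; have q0 : (0 < q ^ c)%N by rewrite expn_gt0 ltnW.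
case: leqP => [le_ce|lt_ec].
  apply: eq_card => j; rewrite !inE -{1}(subnKC le_ce) expnD natrM.
  by rewrite (inj_eq (mulfI _)) // pnatr_eq0 -lt0n.
apply: eq_card0 => j; rewrite !inE; apply/negbTE.
have /natrP[d Dd] := Cnat_irr1 j; have := irr1_gt0 j.
rewrite Dd -natrM eqr_nat ltr0n => d_gt0.
by rewrite gtn_eqF // (leq_trans _ (leq_pmulr _ d_gt0)) // ltn_exp2l.
Qed.

Section NumIrrPattern.

Variables (n : nat) (F : finFieldType).
Local Notation m := n.-1.+1.
Local Notation q := #|F|.

Definition num_irr_pattern (D : rel nat) (e : nat) : rat :=
  (num_irr_deg (pattern_group n F D) (q ^ e))%:R.

(** The exponent of q in the index in [H] of the stabilizer of c e_k, hence the amount by which the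
    exponent of the degree drops. *)
Definition col_count (D : rel nat) (r k : nat) : nat :=
  #|[pred j : 'I_m | D r j && D j k]|.


Let q_gt1 : (1 < q)%N := finNzRing_gt1 F.

(** The zero vector gives the first summand. The (q - 1) q^c vectors with last nonzero entry at [k],
    where c is [col_count D r k], lie in orbits of size q^c, which leaves the factor q - 1. *)
Lemma num_irr_row_chain (D : rel nat) (r : 'I_m) (e : nat) :
  closed_pattern D -> (forall i, ~~ D i r) ->
  (forall j k, D r j -> D r k -> (j < k)%N -> D j k) ->
  num_irr_pattern D e = num_irr_pattern (minus_row D r) e
    + \sum_(k : 'I_m | D r k && (col_count D r k <= e)%N)
        (q%:R - 1) * num_irr_pattern (minus_col D r k) (e - col_count D r k).
Proof.
move=> cD Dr chD; have [ltD trD] := cD.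
have cH := closed_minus_row r cD.
have [w [sum_w w_act w_stab]] := @row_reduction n F D r cD Dr (pred1 (q ^
  e)%:R).
rewrite {1}/num_irr_pattern /num_irr_deg [LHS]sum_w.
have dual0 : 0 \in row_dual F D r by apply/row_dualP=> k _; rewrite ffunE.
rewrite (bigD1 (0 : {ffun 'I_m -> F})) //=; congr (_ + _).
  have [S defS ->] := w_stab 0 dual0.
  have -> : S = pattern_group n F (minus_row D r).
    apply/val_inj; rewrite /= defS; apply/setP=> h; rewrite inE.
    rewrite [X in _ && X](_ : _ = true) ?andbT //; apply/eqP/ffunP=> k.
    by rewrite !ffunE big1 ?if_same // => j _; rewrite ffunE mulr0.
  rewrite indexgg divr1; congr (_%:R); apply: eq_card => j.
  by rewrite !inE mul1r.
pose low (k : 'I_m) := [set x in row_dual F D r | (x k != 0) &&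
  [forall j : 'I_m, (k < j)%N ==> (x j == 0)]].
(* The successor ranks a nonzero entry at index 0 above the zero entries, which are all ranked 0. *)
pose top (x : {ffun 'I_m -> F}) :=
  [arg max_(k > r) (if x k != 0 then k.+1 else 0%N)].
have topP (x : {ffun 'I_m -> F}) :
    x != 0 -> x (top x) != 0 /\ forall j, x j != 0 -> (j <= top x)%N.
  move=> x0; have [k xk] : exists k, x k != 0.
    apply/existsP; apply: contraNT x0; rewrite negb_exists => /forallP x0.
    by apply/eqP/ffunP=> k; apply/eqP; rewrite ffunE; have := x0 k;
      rewrite negbK.
  rewrite /top; case: arg_maxnP => // i _ maxi.
  have xi : x i != 0 by have := maxi k isT; rewrite /= xk; case: ifP.
  by split=> // j xj; have := maxi j isT; rewrite /= xj xi.
rewrite (partition_big top (fun k => D r k)) /= =>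
  [|x /andP[/row_dualP hx x0]]; last first.
  by have [xt _] := topP x x0; apply: contraNT xt => /hx->.
rewrite [RHS]big_mkcondr /=; apply: eq_bigr => k Drk.
rewrite (eq_bigl (fun x => x \in low k)) => [|x]; last first.
  rewrite [RHS]inE -andbA; apply: andb_id2l => hx.
  apply/andP/andP=> [[x0 /eqP<-]|[xk /forallP lowx]].
    have [xt maxx] := topP x x0; split=> //; apply/forallP=> j.
    by apply/implyP; rewrite ltnNge; apply: contraR => /maxx.
  have x0 : x != 0 by apply: contraNneq xk => ->; rewrite ffunE.
  split=> //; have [xt maxx] := topP x x0;
    rewrite -val_eqE eqn_leq maxx // andbT.
  by rewrite leqNgt; apply: contra xt; apply: implyP (lowx _).
set c := col_count D r k.
have cD' := closed_minus_col r k cD.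
have kk : ~~ D k k by apply/negP=> /ltD; rewrite ltnn.
have card_low : #|low k| = (q.-1 * q ^ c)%N.
  (* The values allowed at [j]: nonzero at [k], arbitrary at the columns of row [r] that precede
     [k], and 0 elsewhere. *)
  pose Fk j : pred F := [pred a | if j == k then a != 0
    else if D r j && D j k then true else a == 0].
  have -> : #|low k| = #|(family Fk : simpl_pred {ffun 'I_m -> F})|.
    apply: eq_card => x; apply/idP/familyP.
      rewrite inE => /and3P[/row_dualP hx xk /forallP lowx] j; rewrite inE.
      case: eqP => [->|/eqP jk] //; case: ifP => // /negbT; rewrite negb_and.
      case: (boolP (D r j)) => /= [Drj|/hx-> //] njk.
      apply: implyP (lowx j) _; rewrite ltnNge leq_eqVlt negb_or val_eqE jk.
      by apply: contra njk; apply: chD.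
    move=> hx; rewrite inE; apply/and3P; split.
    - apply/row_dualP=> j nDrj; have := hx j; rewrite inE (negPf nDrj) /=.
      by case: eqP => [jk|_ /eqP//]; rewrite -jk (negPf nDrj) in Drk.
    - by have := hx k; rewrite inE eqxx.
    apply/forallP=> j; apply/implyP=> kj; have := hx j; rewrite inE.
    case: eqP => [jk|_]; first by rewrite jk ltnn in kj.
    by case: ifP => // /andP[_ /ltD]; rewrite ltnNge ltnW.
  rewrite card_family foldrE big_image /= (bigD1 k) //=; congr (_ * _)%N.
    rewrite -(cardC1 (0 : F)); apply: eq_card => a.
    by rewrite !inE eqxx.
  rewrite (bigID (fun j : 'I_m => D r j && D j k)) /=.
  rewrite [X in (_ * X)%N]big1 ?muln1 => [|j /andP[jk nj]]; last first.
    rewrite -(card1 (0 : F)); apply: eq_card => a.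
    by rewrite !inE (negPf jk) (negPf nj).
  rewrite (eq_bigr (fun _ => q)) => [|j /andP[jk dj]]; last first.
    by apply: eq_card => a; rewrite !inE (negPf jk) dj.
  rewrite prod_nat_const; congr (_ ^ _)%N; apply: eq_card => j.
  rewrite !inE unfold_in.
  by case: (eqVneq j k) => [->|] //=; rewrite (negPf kk) andbF.
have card_H : #|pattern_group n F (minus_row D r)| =
    (#|pattern_group n F (minus_col D r k)| * q ^ c)%N.
  rewrite !card_pattern_group // -expnD; congr (_ ^ _)%N.
  rewrite -(cardID [pred p : 'I_m * 'I_m | D r p.1 && (p.2 == k)]) addnC.
  congr (_ + _)%N.
    by apply: eq_card => p; rewrite !inE /minus_col andbC val_eqE.
  have injk : injective (fun j : 'I_m => (j, k)) by move=> ? ? [].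
  rewrite /c /col_count -(card_image injk); apply: eq_card => -[i j].
  rewrite !inE /=; apply/andP/imageP=> [[ij /andP[Dri /eqP jk]]|[i' + [-> ->]]].
    by exists i; rewrite ?jk // inE Dri -jk; case/andP: ij.
  rewrite inE => /andP[Dri' Di'k]; rewrite Dri' eqxx /minus_row Di'k andbT.
  by split=> //; apply: contraTneq Dri' => ->; apply: Dr.
have sub_H : pattern_group n F (minus_col D r k) \subset
    pattern_group n F (minus_row D r).
  apply/subsetP=> h /(pattern_groupP _ cD') hh; apply/(pattern_groupP _ cH).
  by move=> i j nDij; apply: hh; rewrite negb_and nDij.
have index_H : #|pattern_group n F (minus_row D r) :
    pattern_group n F (minus_col D r k)|%g = (q ^ c)%N.
  by rewrite -divgS // card_H mulKn ?cardG_gt0.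
rewrite (eq_bigr (fun _ => (if (c <= e)%N
    then num_irr_pattern (minus_col D r k) (e - c) else 0) / (q ^ c)%:R)).
  rewrite sumr_const card_low -[LHS]mulr_natl natrM.
  have qc0 : (q ^ c)%:R != 0 :> rat by rewrite pnatr_eq0 -lt0n expn_gt0 ltnW.
  rewrite mulrACA divff // mulr1 -subn1 natrB ?(ltnW q_gt1) //.
  by case: ifP; rewrite ?mulr0.
move=> x; rewrite inE => /and3P[hx xk /forallP lowx].
pose d : {ffun 'I_m -> F} := [ffun j => if j == k then x k else 0].
have dd : d \in row_dual F D r.
  apply/row_dualP=> j nDrj; rewrite ffunE; case: eqP => // jk.
  by rewrite -jk (negPf nDrj) in Drk.
(* Column [k] of this matrix is x divided by [x k], so it sends [d] to x. A column i of row [r]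
   other than [k] without [D i k] comes after [k], where x vanishes. *)
pose A : 'M[F]_m := \matrix_(i, j) if (j == k) && D r i && D i k
  then x i / x k else (i == j)%:R.
have [i j|h Hh Dh] := @pattern_mx n F _ A cH.
  rewrite mxE; case: ifP => // /andP[/andP[/eqP-> Dri] Dik].
  by rewrite /minus_row Dik andbT negbK => /eqP ir;
    rewrite ir (negPf (Dr _)) in Dri.
have actd (g : {'GL_n[F]}) (i : 'I_m) :
    D r i -> col_action D r g d i = GLval g i k * x k.
  move=> Dri; rewrite ffunE Dri (bigD1 k) //= ffunE eqxx big1 ?addr0 // => j jk.
  by rewrite ffunE (negPf jk) mulr0.
have -> : x = col_action D r h d.
  apply/ffunP=> i; have [Dri|nDri] := boolP (D r i); last first.
    by rewrite ffunE (negPf nDri) (row_dualP _ _ _ hx).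
  rewrite actd // Dh mxE eqxx Dri /=; case: ifP => [_|/negbT nDik].
    by rewrite divfK.
  case: eqP => [->|/eqP ik]; first by rewrite mul1r.
  rewrite mul0r; apply/eqP; apply: implyP (lowx i) _.
  rewrite ltnNge leq_eqVlt negb_or val_eqE ik.
  by apply: contra nDik; apply: chD.
rewrite w_act //; have [S defS ->] := w_stab d dd.
have -> : S = pattern_group n F (minus_col D r k).
  apply/val_inj; rewrite /= defS; apply/setP=> g; rewrite inE.
  apply/andP/idP=> [[Hg /eqP/ffunP gd]|Mg].
    apply/(pattern_groupP _ cD')=> i j; rewrite negb_and negbK.
    case/orP=> [|/andP[Dri /eqP/val_inj->]];
      first exact: (pattern_groupP _ cH Hg).
    have := gd i; rewrite actd // ffunE; case: eqP => _.
      by rewrite -{2}[x k]mul1r => /(mulIf xk).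
    by move/eqP; rewrite mulf_eq0 (negPf xk) orbF => /eqP.
  split; first exact: (subsetP sub_H).
  apply/eqP/ffunP=> i; have [Dri|nDri] := boolP (D r i); last first.
    by rewrite ffunE (negPf nDri) (row_dualP _ _ _ dd).
  rewrite actd // (pattern_groupP _ cD' Mg) ?ffunE; last first.
    by rewrite negb_and negbK Dri eqxx orbT.
  by case: eqP => _; rewrite ?mul1r ?mul0r.
rewrite index_H irr_deg_mul //; congr (_ / _).
by case: ifP.
Qed.

(* A vector supported on M is fixed by H, and for any other x, with x k != 0 and
   k outside M, the matrices of H that differ from 1 only in column k act freely
   on x, so that the orbit of x is too large. *)
Lemma num_irr_row_minimal (D : rel nat) (r : 'I_m) (M : {set 'I_m}) (e : nat) :
  closed_pattern D -> (forall i, ~~ D i r) ->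
  (forall l, l \in M -> D r l) ->
  (forall j l, l \in M -> D r j -> ~~ D j l) ->
  (forall k : 'I_m, D r k -> k \notin M -> (e < col_count D r k)%N) ->
  num_irr_pattern D e = q%:R ^+ #|M| * num_irr_pattern (minus_row D r) e.
Proof.
move=> cD Dr rM minM bigk; have [ltD trD] := cD.
have cH := closed_minus_row r cD.
have [w [sum_w w_act w_stab]] := @row_reduction n F D r cD Dr (pred1 (q ^
  e)%:R).
rewrite {1}/num_irr_pattern /num_irr_deg [LHS]sum_w.
pose dualM := pffun_on (0 : F) (mem M) (predT : {pred F}).
have dualMP (x : {ffun 'I_m -> F}) :
    reflect (forall k, k \notin M -> x k = 0) (x \in dualM).
  apply: (iffP pffun_onP) => [[/supportP//]|hx].
  by split=> //; apply/supportP.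
rewrite (bigID (fun x => x \in dualM)) /= [X in _ + X]big1 ?addr0; last first.
  move=> x /andP[hx /dualMP xM]; have [S defS ->] := w_stab x hx.
  have [k [Drk kM xk]] : exists k : 'I_m, [/\ D r k, k \notin M & x k != 0].
    have [k /and3P[]|nok] := pickP (fun k : 'I_m =>
      [&& D r k, k \notin M & x k != 0]).
      by exists k.
    case: xM => k kM; have := nok k; rewrite kM /=.
    by have [Drk /eqP//|nDrk _] := boolP (D r k); rewrite (row_dualP _ _ _ hx).
  pose W : rel nat := fun i j => [&& D r i, D i j & j == k].
  have cW : closed_pattern W.
    split=> [i j /and3P[_ /ltD]//|y u z /and3P[_ _ /eqP->] /and3P[_ /ltD kz
      /eqP zk]].
    by have := ltnn k; rewrite -{2}zk kz.
  have sWH : pattern_group n F W \subset pattern_group n F (minus_row D r).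
    apply/subsetP=> h /(pattern_groupP _ cW) hh; apply/(pattern_groupP _ cH).
    move=> i j nDij; apply: hh; apply: contra nDij => /and3P[Dri Dij _].
    by rewrite /minus_row Dij andbT; apply: contraTneq Dri => ->; apply: Dr.
  have sSH : S \subset pattern_group n F (minus_row D r).
    by rewrite defS; apply/subsetP=> h; rewrite inE => /andP[].
  have tiWS : pattern_group n F W :&: S = 1%g.
    apply/trivgP/subsetP=> g /setIP[Wg]; rewrite {1}defS !inE.
    case/andP=> Hg /eqP/ffunP gx; apply/eqP/GL_inj=> i j.
    rewrite [RHS](_ : _ = (i == j)%:R); last by rewrite GL_1E mxE.
    have [Wij|nWij] := boolP (W i j); last exact: (pattern_groupP _ cW Wg).
    case/and3P: Wij => Dri Dij /eqP/val_inj jk; rewrite {j}jk in Dij *.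
    have ik : i != k by apply: contraTneq Dij => ->; apply/negP=> /ltD;
      rewrite ltnn.
    have := gx i; rewrite ffunE Dri (bigD1 i) //= (bigD1 k) 1?eq_sym //=.
    rewrite big1 ?addr0 => [|l /andP[li lk]]; last first.
      rewrite (pattern_groupP _ cW Wg) 1?eq_sym ?(negPf li) ?mul0r //.
      by rewrite /W val_eqE (negPf lk) !andbF.
    rewrite (pattern_groupP _ cW Wg) ?eqxx ?mul1r; last first.
      by apply/negP=> /and3P[_ /ltD]; rewrite ltnn.
    rewrite -[RHS]addr0 => /addrI/eqP;
      rewrite mulf_eq0 (negPf xk) orbF => /eqP->.
    by rewrite eq_sym (negPf ik).
  have card_W : #|pattern_group n F W| = (q ^ col_count D r k)%N.
    rewrite card_pattern_group //; congr (_ ^ _)%N.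
    have injk : injective (fun j : 'I_m => (j, k)) by move=> ? ? [].
    rewrite /col_count -(card_image injk); apply: eq_card => -[i j].
    rewrite !inE /=; apply/and3P/imageP=> [[Dri Dij /eqP/val_inj jk]|[i' + [->
      ->]]].
      by exists i; rewrite ?jk // inE Dri -jk.
    by rewrite inE => /andP[-> ->].
  (* The group of [W] meets the stabilizer [S] trivially, so its order bounds |H : S| from below,
     and every degree over x exceeds q^e. *)
  have le_ind : (q ^ col_count D r k
      <= #|pattern_group n F (minus_row D r) : S|%g)%N.
    rewrite -(leq_pmul2l (cardG_gt0 S)) Lagrange // -card_W mulnC -TI_cardMg //.
    by rewrite subset_leq_card // mul_subG.
  rewrite eq_card0 ?mul0r // => j; rewrite !inE; apply/negbTE.
  have /natrP[d Dd] := Cnat_irr1 j; have := irr1_gt0 j.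
  rewrite Dd -natrM eqr_nat ltr0n => d_gt0.
  rewrite gtn_eqF // (leq_trans _ (leq_pmulr _ d_gt0)) //.
  by rewrite (leq_trans _ le_ind) // ltn_exp2l // bigk.
rewrite (eq_bigl (fun x => x \in dualM)) => [|x]; last first.
  apply: andb_idl => /dualMP hx; apply/row_dualP=> k nDrk; apply: hx.
  by apply: contra nDrk; apply: rM.
rewrite (eq_bigr (fun _ => num_irr_pattern (minus_row D r) e)) =>
  [|x /dualMP hx].
  by rewrite sumr_const card_pffun_on -[LHS]mulr_natl natrX.
have xd : x \in row_dual F D r.
  by apply/row_dualP=> k nDrk; apply: hx; apply: contra nDrk; apply: rM.
have [S defS ->] := w_stab x xd.
have -> : S = pattern_group n F (minus_row D r).
  apply/val_inj; rewrite /= defS; apply/setP=> h; rewrite inE.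
  apply: andb_idr => Hh; apply/eqP/ffunP=> i; rewrite ffunE.
  case: ifP => [Dri|/negbT nDri]; last by rewrite (row_dualP _ _ _ xd).
  rewrite (bigD1 i) //= (pattern_groupP _ cH Hh) ?eqxx ?mul1r; last first.
    by rewrite negb_and; apply/orP; right; apply/negP=> /ltD; rewrite ltnn.
  (* A column [j] in [M] is minimal in row [r], so [h] has no entry at (i, j) that could move x. *)
  rewrite big1 ?addr0 // => j ji; have [jM|/hx->] := boolP (j \in M);
    last by rewrite mulr0.
  rewrite (pattern_groupP _ cH Hh) 1?eq_sym ?(negPf ji) ?mul0r //.
  by rewrite negb_and (minM _ _ jM) ?orbT.
rewrite indexgg divr1; congr (_%:R); apply: eq_card => j.
by rewrite !inE mul1r.
Qed.

End NumIrrPattern.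

(** * Row expansion with explicit lists of columns *)

Lemma card_ord_seq (m : nat) (P : pred nat) (s : seq nat) :
  uniq s -> (forall k, (k < m)%N -> P k = (k \in s)) ->
  all (fun k => k < m)%N s ->
  perm_eq [seq k <- iota 0 m | P k] s.
Proof.
move=> us Ps sm; apply: uniq_perm => //;
  first by rewrite filter_uniq ?iota_uniq.
move=> k; rewrite mem_filter mem_iota add0n /= andbC.
by case: ltnP => [/Ps//|le_mk]; apply/esym/negP=> /(allP sm);
  rewrite ltnNge le_mk.
Qed.

Lemma card_ord_filter (m : nat) (P : pred nat) :
  #|[pred j : 'I_m | P j]| = size [seq j <- iota 0 m | P j].
Proof.
rewrite -sum1_card -sum1_size big_filter.
transitivity (\sum_(0 <= j < m | P j) 1)%N; last by rewrite /index_iota subn0.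
by rewrite big_mkord; apply: eq_bigl => j; rewrite inE.
Qed.

Section Sequences.

Variables (n : nat) (F : finFieldType).
Local Notation m := n.-1.+1.
Local Notation q := #|F|.
Local Notation N := (num_irr_pattern n F).

Lemma eq_num_irr_pattern D D' e :
  (forall i j : nat, (i < m)%N -> (j < m)%N -> D i j = D' i j) ->
  N D e = N D' e.
Proof. by move=> eqD; rewrite /num_irr_pattern (eq_pattern_group F eqD). Qed.

(** In an increasing list of the first columns of row [r], the entry at index t has [col_count] t.
    So [s] either lists the whole row or its first e + 1 columns; the later ones force too large a
    degree. *)
Lemma num_irr_chain (D : rel nat) (r e : nat) (s : seq nat) :
  (r < m)%N -> closed_pattern D -> (forall i, ~~ D i r) ->
  (forall j k, D r j -> D r k -> (j < k)%N -> D j k) ->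
  sorted ltn s -> all (fun k => D r k && (k < m))%N s -> (size s <= e.+1)%N ->
  (forall k, (k < m)%N -> D r k -> k \notin s ->
     (e < size s)%N && all (fun j => j < k)%N s) ->
  N D e = N (minus_row D r) e
    + \sum_(t <- iota 0 (size s))
        (q%:R - 1) * N (minus_col D r (nth 0%N s t)) (e - t).
Proof.
move=> rm cD Dr chD srt sR sz_s Rs; have [ltD trD] := cD.
rewrite (@num_irr_row_chain n F D (Ordinal rm) e) //=; congr (_ + _).
have us : uniq s := sorted_uniq ltn_trans ltnn srt.
have cnt k : (k < m)%N -> D r k ->
    col_count n D r k = size [seq j <- iota 0 m | D r j && (j < k)%N].
  move=> km Drk; rewrite /col_count (card_ord_filter m (fun j =>
    D r j && D j k)).
  congr size; apply: eq_filter => j; apply: andb_id2l => Drj.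
  by apply/idP/idP => [/ltD|/chD->].
have cnt_in t : (t < size s)%N -> col_count n D r (nth 0%N s t) = t.
  move=> ts; have /andP[Dk km] := allP sR _ (mem_nth 0%N ts).
  rewrite cnt // -[RHS](size_takel (ltnW ts)); apply/perm_size/card_ord_seq.
  - exact: take_uniq.
  - move=> j jm; have [js|njs] := boolP (j \in s).
      have /andP[-> _] := allP sR _ js.
      rewrite -{1}(nth_index 0%N js) /= in_take //.
      have js' : (index j s < size s)%N by rewrite index_mem.
      have nth_lt := sorted_ltn_nth ltn_trans 0%N srt.
      case: (ltngtP (index j s) t) => [jt|tj|->]; last by rewrite ltnn.
        exact: nth_lt.
      by apply/negbTE; rewrite -leqNgt ltnW //; apply: nth_lt.
    have -> : (j \in take t s) = false by apply: contraNF njs; apply: mem_take.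
    apply: contraNF njs => /andP[Drj jk]; apply: contraLR jk => njs.
    have /andP[_ /allP lts] := Rs j jm Drj njs.
    by rewrite -leqNgt ltnW // lts ?mem_nth.
  apply/allP=> j /mem_take js; by case/andP: (allP sR _ js).
have cnt_out k : (k < m)%N -> D r k -> k \notin s -> (e < col_count n D r k)%N.
  move=> km Drk ks; have /andP[es /allP lts] := Rs k km Drk ks.
  rewrite cnt // (leq_trans es) // uniq_leq_size // => j js.
  have /andP[Drj jm] := allP sR _ js.
  by rewrite mem_filter Drj lts // mem_iota.
have Ps k : (k < m)%N -> D r k && (col_count n D r k <= e)%N = (k \in s).
  move=> km; have [ks|ks] := boolP (k \in s).
    have /andP[-> _] := allP sR _ ks.
    rewrite -(nth_index 0%N ks) cnt_in ?index_mem //=.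
    by rewrite -ltnS (leq_trans _ sz_s) // index_mem.
  by apply/negP=> /andP[Drk]; rewrite leqNgt cnt_out.
transitivity (\sum_(0 <= k < m | D r k && (col_count n D r k <= e)%N)
   (q%:R - 1) * N (minus_col D r k) (e - col_count n D r k)).
  by rewrite big_mkord.
rewrite -[LHS]big_filter [LHS](perm_big s); last first.
  rewrite /index_iota subn0; apply: card_ord_seq => //.
  by apply/allP=> k ks; case/andP: (allP sR _ ks).
rewrite [LHS](big_nth 0%N) /index_iota subn0.
by apply: eq_big_seq => t; rewrite mem_iota add0n => /andP[_ ts];
  rewrite cnt_in.
Qed.

(** The list [s'] is a witness that [col_count] exceeds [e] at a column outside [s]. *)
Lemma num_irr_minimal (D : rel nat) (r e : nat) (s : seq nat) :
  (r < m)%N -> closed_pattern D -> (forall i, ~~ D i r) ->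
  uniq s -> all (fun k => D r k && (k < m))%N s ->
  (forall j l, l \in s -> D r j -> ~~ D j l) ->
  (forall k, (k < m)%N -> D r k -> k \notin s -> exists2 s' : seq nat,
     uniq s' && (e < size s')%N
     & all (fun j => [&& (j < m)%N, D r j & D j k]) s') ->
  N D e = q%:R ^+ size s * N (minus_row D r) e.
Proof.
move=> rm cD Dr us sR mins big_s.
pose M := [set l : 'I_m | (l : nat) \in s].
have -> : size s = #|M|.
  rewrite cardsE (card_ord_filter m (fun j => j \in s)); apply/esym/perm_size.
  apply: card_ord_seq => //; apply/allP=> k ks; by case/andP: (allP sR _ ks).
apply: (@num_irr_row_minimal n F D (Ordinal rm)) => //= [l|j l|k Drk].
- by rewrite inE => /(allP sR)/andP[].
- by rewrite inE => /mins; apply.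
rewrite inE => /(big_s _ (ltn_ord k) Drk)[s' /andP[us' es'] /allP s'k].
rewrite (leq_trans es') // /col_count.
rewrite (card_ord_filter m (fun j => D r j && D j k)) uniq_leq_size // => j js'.
have /and3P[jm Drj Djk] := s'k j js'.
by rewrite mem_filter Drj Djk mem_iota.
Qed.

(** The squares of the degrees sum to |G|, which is at most q^(2e). The principal character already
    contributes 1, so no room is left for a degree q^e. *)
Lemma num_irr_small (D : rel nat) (e : nat) (s : seq (nat * nat)) :
  closed_pattern D -> (forall i j, (j < m)%N -> D i j -> (i, j) \in s) ->
  (0 < e)%N -> (size s <= e.*2)%N -> N D e = 0.
Proof.
move=> cD Ds e0 sz_s; set G := pattern_group n F D.
have cardG : (#|G| <= q ^ e.*2)%N.
  rewrite card_pattern_group // leq_exp2l ?finNzRing_gt1 // (leq_trans _ sz_s) //.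
  pose f (p : 'I_m * 'I_m) := (val p.1, val p.2).
  have injf : injective f by move=> [a b] [c d] [/val_inj-> /val_inj->].
  rewrite cardE -(size_map f) uniq_leq_size ?map_inj_uniq ?enum_uniq //.
  by move=> _ /mapP[[i j] + ->]; rewrite mem_enum inE => /Ds; apply.
suff G0 : num_irr_deg G (q ^ e) = 0%N by rewrite /N -/G G0.
apply: eq_card0 => i; rewrite !inE; apply: contraTF cardG => /eqP Di.
have i0 : i != 0.
  apply: contra_eq_neq Di => ->; rewrite irr0 cfun11 eq_sym pnatr_eq1.
  by rewrite gtn_eqF // -(exp1n e) ltn_exp2r // finNzRing_gt1.
have := irr_sum_square G; rewrite (bigD1 i) // (bigD1 0) 1?eq_sym //=.
rewrite Di irr0 cfun11 expr1n -natrX => /esym cardE.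
rewrite -ltnNge -(ltr_nat algC) cardE addrA -muln2 expnM.
rewrite ltr_wpDr ?ltrDl ?ltr01 // sumr_ge0 // => j _.
by rewrite exprn_ge0 // char1_ge0 ?irr_char.
Qed.

Lemma num_irr_trivial (D : rel nat) :
  (forall i j, (j < m)%N -> ~~ D i j) -> N D 0 = 1.
Proof.
move=> D0; rewrite /num_irr_pattern.
have -> : pattern_group n F D = 1%G.
  apply/val_inj/trivgP; rewrite gen_subG; apply/subsetP=> g /pattern_setP hg.
  rewrite inE; apply/eqP/GL_inj=> i j; rewrite hg ?D0 //.
  by rewrite [RHS](_ : _ = (i == j)%:R) // GL_1E mxE.
have ab1 : abelian (1%G : {group {'GL_n[F]}}) by rewrite abelian1.
rewrite /num_irr_deg expn0 (_ : [set i | _] = setT).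
  by rewrite cardsT (card_Iirr_abelian ab1) cards1.
apply/setP=> i; rewrite !inE; apply/eqP/lin_char1.
exact/char_abelianP.
Qed.

End Sequences.

(** * The patterns reached from the unitriangular groups *)

(* Z lists the removed positions, relative to the start index s: the group lives
   on the indices s, ..., n - 1, so that its size decreases with n fixed. *)
Definition unitri_pattern (s : nat) (Z : seq (nat * nat)) : rel nat :=
  fun i j => [&& (s <= i)%N, (i < j)%N & (i - s, j - s)%N \notin Z].

Local Notation pat := unitri_pattern.

Ltac pat_lia :=
  rewrite /= /minus_row /minus_col /unitri_pattern ?inE ?xpair_eqE /=; lia.

Section Values.

Variables (n : nat) (F : finFieldType).
Local Notation m := n.-1.+1.
Local Notation q := (#|F|%:R : rat).
Local Notation N s Z := (num_irr_pattern n F (unitri_pattern s Z)).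

(* cZ lists the first columns k of row s, relative to s, each with the pattern
   that remains when column k loses its positions (j, k) for j a column of
   row s. *)
Lemma num_irr_unitri_chain s e Z Z0 (cZ : seq (nat * seq (nat * nat))) :
  (s < m)%N -> closed_pattern (pat s Z) ->
  (forall j k, pat s Z s j -> pat s Z s k -> (j < k)%N -> pat s Z j k) ->
  sorted ltn (unzip1 cZ) ->
  all (fun k => pat s Z s (s + k) && (s + k < m))%N (unzip1 cZ) ->
  (size cZ <= e.+1)%N ->
  (forall k, (k < m)%N -> pat s Z s k -> (k - s)%N \notin unzip1 cZ ->
     (e < size cZ)%N && all (fun j => s + j < k)%N (unzip1 cZ)) ->
  (forall i j, (s < i)%N -> pat s Z i j = pat s.+1 Z0 i j) ->
  (forall t i j, (t < size cZ)%N -> (s < i)%N ->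
    let kZ := nth (0%N, [::]) cZ t in
    pat s Z i j && ~~ (pat s Z s i && (j == s + kZ.1)%N)
      = pat s.+1 kZ.2 i j) ->
  N s Z e = N s.+1 Z0 e
    + \sum_(t <- iota 0 (size cZ))
        (q - 1) * N s.+1 (nth (0%N, [::]) cZ t).2 (e - t).
Proof.
move=> sm cD chD srt all_c sz_c rest eq0 eqt.
have low i j : pat s Z i j -> i != s -> (s < i)%N.
  by case/and3P=> si _ _; rewrite ltn_neqAle eq_sym si andbT.
have lowS (Z' : seq (nat * nat)) i j :
    pat s.+1 Z' i j -> (s < i)%N by case/and3P.
rewrite (@num_irr_chain n F _ s e [seq (s + k)%N | k <- unzip1 cZ]) //.
- congr (_ + _).
    apply: eq_num_irr_pattern => i j _ _; rewrite /minus_row.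
    apply/andP/idP=> [[si Dij]|Dij]; first by rewrite -eq0 // (low _ _ Dij).
    by have si := lowS _ _ _ Dij; rewrite eq0 // gtn_eqF.
  rewrite !size_map; apply: eq_big_seq => t;
    rewrite mem_iota add0n => /andP[_ ts].
  congr (_ * _); apply: eq_num_irr_pattern => i j _ _.
  rewrite /minus_col /minus_row (nth_map 0%N) ?size_map // (nth_map (0%N,
    [::])) //.
  apply/idP/idP=> [/andP[/andP[si Dij] nD]|Dij].
    by rewrite -eqt // ?(low _ _ Dij) // Dij.
  have si := lowS _ _ _ Dij; rewrite -eqt // in Dij.
  by case/andP: Dij => -> ->; rewrite gtn_eqF.
- by move=> i; apply/negP=> /and3P[si]; rewrite ltnNge si.
- by rewrite sorted_map (eq_sorted (e' := ltn)) // => i j; rewrite /= ltn_add2l.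
- by rewrite all_map.
- by rewrite !size_map.
move=> k km Dk nk; rewrite all_map !size_map; apply: rest => //.
apply: contra nk => nk; apply/mapP; exists (k - s)%N => //.
by case/and3P: Dk => _ sk _; rewrite subnKC // ltnW.
Qed.

(* c lists the minimal columns of row s and w the rows that make the orbits of
   all other columns large, both relative to s. *)
Lemma num_irr_unitri_minimal s e Z Z0 (c w : seq nat) :
  (s < m)%N -> closed_pattern (pat s Z) -> uniq c ->
  all (fun k => pat s Z s (s + k) && (s + k < m))%N c ->
  (forall j l, l \in c -> pat s Z s j -> ~~ pat s Z j (s + l)) ->
  uniq w -> (e < size w)%N ->
  (forall k, (k < m)%N -> pat s Z s k -> (k - s)%N \notin c ->
     all (fun j => pat s Z s (s + j) && pat s Z (s + j) k)%N w) ->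
  (forall i j, (s < i)%N -> pat s Z i j = pat s.+1 Z0 i j) ->
  N s Z e = q ^+ size c * N s.+1 Z0 e.
Proof.
move=> sm cD uc all_c minc uw ew rest eq0.
have inj_s : injective (addn s) by move=> i j /addnI.
rewrite (@num_irr_minimal n F _ s e [seq (s + k)%N | k <- c]) //.
- rewrite size_map; congr (_ * _).
  apply: eq_num_irr_pattern => i j _ _; rewrite /minus_row.
  apply/andP/idP=> [[si Dij]|Dij].
    rewrite -eq0 //; case/and3P: Dij => le_si _ _.
    by rewrite ltn_neqAle eq_sym si.
  by have /and3P[si _ _] := Dij; rewrite eq0 // gtn_eqF.
- by move=> i; apply/negP=> /and3P[si]; rewrite ltnNge si.
- by rewrite map_inj_uniq.
- by rewrite all_map.
- by move=> j _ /mapP[l lc ->]; apply: minc.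
move=> k km Dk nk; exists [seq (s + j)%N | j <- w].
  by rewrite map_inj_uniq // uw size_map.
have /rest : (k - s)%N \notin c.
  apply: contra nk => nk; apply/mapP; exists (k - s)%N => //.
  by case/and3P: Dk => _ sk _; rewrite subnKC // ltnW.
rewrite all_map => /(_ km Dk) /allP rw; apply/allP=> j /rw /andP[Dj Djk] /=.
by rewrite Dj Djk !andbT (ltn_trans _ km) //; case/and3P: Djk.
Qed.

(* Tk empties column k, counted from 1; Uij has (i, j) as its first removed
   position, again counted from 1. In the names below the pattern is followed by
   the exponent of the degree and, if it is fixed, by the size. *)
Local Notation T2 := [:: (0, 1)]%N.
Local Notation T3 := [:: (0, 2); (1, 2)]%N.
Local Notation T4 := [:: (0, 3); (1, 3); (2, 3)]%N.
Local Notation U23 := [:: (1, 2)]%N.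
Local Notation U24 := [:: (1, 3); (2, 3)]%N.
Local Notation U12 := [:: (0, 1); (0, 2)]%N.

(** Unfolded, all side conditions are linear arithmetic on positions. At most four columns are ever
    listed, so the case split on an index stops at 4. *)
Ltac side_goals :=
  first [ by [] | lia
    | split=> [? ?|? ? ?]; pat_lia
    | case=> [|[|[|[|?]]]] ? ? //=; pat_lia
    | move=> ? ?; pat_lia
    | move=> ?; pat_lia
    | pat_lia ].

(* Unlocking evaluates the sum over the concrete list [cZ], so that [ring] sees its terms. *)
Tactic Notation "chain_rec" constr(Z0) constr(cZ) :=
  rewrite (@num_irr_unitri_chain _ _ _ Z0 cZ);
    [rewrite unlock /= ?subSS ?subn0; ring | side_goals ..].

Tactic Notation "minimal_rec" constr(Z0) constr(c) constr(w) :=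
  rewrite (@num_irr_unitri_minimal _ _ _ Z0 c w);
    [rewrite /= ?expr1 ?expr0 ?mul1r // | side_goals ..].

(** * Recursions among the patterns *)

Lemma num_irr_U_0_rec s : (s + 2 <= m)%N -> N s [::] 0 = q * N s.+1 [::] 0.
Proof. by move=> sm; minimal_rec (Nil (nat * nat)) [:: 1]%N [:: 1]%N. Qed.

Lemma num_irr_T2_0_rec s : (s + 3 <= m)%N -> N s T2 0 = q * N s.+1 [::] 0.
Proof. by move=> sm; minimal_rec (Nil (nat * nat)) [:: 2]%N [:: 2]%N. Qed.

(** Here row [s] is empty, so the condition on the list of rows holds vacuously; the list only has
    to be nonempty. *)
Lemma num_irr_T2_0_2_rec s : (s + 2 = m)%N -> N s T2 0 = N s.+1 [::] 0.
Proof. by move=> sm; minimal_rec (Nil (nat * nat)) (Nil nat) [:: 1]%N. Qed.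

Lemma num_irr_T3_0_rec s : (s + 3 <= m)%N -> N s T3 0 = q * N s.+1 T2 0.
Proof. by move=> sm; minimal_rec T2 [:: 1]%N [:: 1]%N. Qed.

Lemma num_irr_T4_0_rec s : (s + 4 <= m)%N -> N s T4 0 = q * N s.+1 T3 0.
Proof. by move=> sm; minimal_rec T3 [:: 1]%N [:: 1]%N. Qed.

Lemma num_irr_U23_0_rec s : (s + 3 <= m)%N -> N s U23 0 = q ^+ 2 * N s.+1 T2 0.
Proof. by move=> sm; minimal_rec T2 [:: 1; 2]%N [:: 1]%N. Qed.

Lemma num_irr_U24_0_rec s : (s + 4 <= m)%N -> N s U24 0 = q ^+ 2 * N s.+1 T3 0.
Proof. by move=> sm; minimal_rec T3 [:: 1; 3]%N [:: 1]%N. Qed.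

Lemma num_irr_U12_0_rec s : (s + 4 <= m)%N -> N s U12 0 = q * N s.+1 [::] 0.
Proof. by move=> sm; minimal_rec (Nil (nat * nat)) [:: 3]%N [:: 3]%N. Qed.

Lemma num_irr_U12_0_3_rec s : (s + 3 = m)%N -> N s U12 0 = N s.+1 [::] 0.
Proof. by move=> sm; minimal_rec (Nil (nat * nat)) (Nil nat) [:: 1]%N. Qed.

Lemma num_irr_U_1_rec s : (s + 3 <= m)%N ->
  N s [::] 1 = N s.+1 [::] 1
    + (q - 1) * N s.+1 [::] 1
    + (q - 1) * N s.+1 T2 0.
Proof. by move=> sm; chain_rec (Nil (nat * nat)) [:: (1, [::]); (2, T2)]%N. Qed.

Lemma num_irr_T2_1_rec s : (s + 4 <= m)%N ->
  N s T2 1 = N s.+1 [::] 1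
    + (q - 1) * N s.+1 [::] 1
    + (q - 1) * N s.+1 U23 0.
Proof.
by move=> sm; chain_rec (Nil (nat * nat)) [:: (2, [::]); (3, U23)]%N.
Qed.

(** Relative to [s], 2 is not a column of the row, so choosing column 3 removes (1, 3) but keeps (2,
    3). Together with the missing (1, 2) this gives [U12]. *)
Lemma num_irr_T3_1_rec s : (s + 4 <= m)%N ->
  N s T3 1 = N s.+1 T2 1
    + (q - 1) * N s.+1 T2 1
    + (q - 1) * N s.+1 U12 0.
Proof. by move=> sm; chain_rec T2 [:: (1, T2); (3, U12)]%N. Qed.

(** Columns 1 and 2 are incomparable, so the row is not a chain; but every later column lies above
    both, which makes its orbits larger than q. *)
Lemma num_irr_U23_1_rec s : (s + 3 <= m)%N -> N s U23 1 = q ^+ 2 * N s.+1 T2 1.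
Proof. by move=> sm; minimal_rec T2 [:: 1; 2]%N [:: 1; 2]%N. Qed.

Lemma num_irr_U_2_rec s : (s + 4 <= m)%N ->
  N s [::] 2 = N s.+1 [::] 2
    + (q - 1) * N s.+1 [::] 2
    + (q - 1) * N s.+1 T2 1
    + (q - 1) * N s.+1 T3 0.
Proof.
by move=> sm; chain_rec (Nil (nat * nat)) [:: (1, [::]); (2, T2); (3, T3)]%N.
Qed.

Lemma num_irr_T2_2_rec s : (s + 5 <= m)%N ->
  N s T2 2 = N s.+1 [::] 2
    + (q - 1) * N s.+1 [::] 2
    + (q - 1) * N s.+1 U23 1
    + (q - 1) * N s.+1 U24 0.
Proof.
by move=> sm; chain_rec (Nil (nat * nat)) [:: (2, [::]); (3, U23); (4, U24)]%N.
Qed.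

(** In size 4 the column that leads to [U24] does not exist. *)
Lemma num_irr_T2_2_4_rec s : (s + 4 = m)%N ->
  N s T2 2 = N s.+1 [::] 2
    + (q - 1) * N s.+1 [::] 2
    + (q - 1) * N s.+1 U23 1.
Proof.
by move=> sm; chain_rec (Nil (nat * nat)) [:: (2, [::]); (3, U23)]%N.
Qed.

(** Column k of the row, relative to [s], has orbits of size q^(k-1), so exactly four columns count.
    Choosing column k empties column k of the next group, counted from 1. *)
Lemma num_irr_U_3_rec s : (s + 5 <= m)%N ->
  N s [::] 3 = N s.+1 [::] 3
    + (q - 1) * N s.+1 [::] 3
    + (q - 1) * N s.+1 T2 2
    + (q - 1) * N s.+1 T3 1
    + (q - 1) * N s.+1 T4 0.
Proof.
by move=> sm; chain_rec (Nil (nat * nat)) [:: (1, [::]); (2, T2); (3, T3);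
  (4, T4)]%N.
Qed.

(** * Groups too small for the given degree *)

Lemma num_irr_U_1_2_eq0 s : (s + 2 = m)%N -> N s [::] 1 = 0.
Proof.
move=> sm; apply: (@num_irr_small _ _ _ _ [:: (s + 0, s + 1)]%N) => //.
  by side_goals.
move=> i j; pat_lia.
Qed.

Lemma num_irr_U_2_3_eq0 s : (s + 3 = m)%N -> N s [::] 2 = 0.
Proof.
move=> sm; apply: (@num_irr_small _ _ _ _ [:: (s + 0, s + 1); (s + 0, s + 2);
  (s + 1, s + 2)]%N) => //.
  by side_goals.
move=> i j; pat_lia.
Qed.

(** The borderline case of [num_irr_small]: the order q^6 is exactly the square of the degree. *)
Lemma num_irr_U_3_4_eq0 s : (s + 4 = m)%N -> N s [::] 3 = 0.
Proof.
move=> sm; apply: (@num_irr_small _ _ _ _ [:: (s + 0, s + 1); (s + 0, s + 2);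
  (s + 0, s + 3); (s + 1, s + 2); (s + 1, s + 3); (s + 2, s + 3)]%N) => //.
  by side_goals.
move=> i j; pat_lia.
Qed.

Lemma num_irr_T2_1_3_eq0 s : (s + 3 = m)%N -> N s T2 1 = 0.
Proof.
move=> sm; apply: (@num_irr_small _ _ _ _ [:: (s + 0, s + 2);
  (s + 1, s + 2)]%N) => //.
  by side_goals.
move=> i j; pat_lia.
Qed.

Lemma num_irr_U23_1_3_eq0 s : (s + 3 = m)%N -> N s U23 1 = 0.
Proof.
move=> sm; apply: (@num_irr_small _ _ _ _ [:: (s + 0, s + 1);
  (s + 0, s + 2)]%N) => //.
  by side_goals.
move=> i j; pat_lia.
Qed.

(** * Closed forms *)

Lemma num_irr_U_0 p s : (s + p.+1 = m)%N -> N s [::] 0 = q ^+ p.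
Proof.
elim: p s => [|p IH] s sp.
  apply: num_irr_trivial => i j; rewrite /unitri_pattern; lia.
by rewrite num_irr_U_0_rec ?IH ?exprS //; lia.
Qed.

Lemma num_irr_T2_0 p s : (s + p.+3 = m)%N -> N s T2 0 = q ^+ p.+2.
Proof.
by move=> sp; rewrite num_irr_T2_0_rec ?(@num_irr_U_0 p.+1) ?exprS //; lia.
Qed.

(** An exception, as the general formula would give q. The smallest sizes of [T3], [T4], [U23] and
    [U24] inherit it and are stated separately as well. *)
Lemma num_irr_T2_0_2 s : (s + 2 = m)%N -> N s T2 0 = 1.
Proof. by move=> sp; rewrite num_irr_T2_0_2_rec ?(@num_irr_U_0 0) //; lia. Qed.

Lemma num_irr_T3_0 p s : (s + p.+4 = m)%N -> N s T3 0 = q ^+ p.+3.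
Proof.
by move=> sp; rewrite num_irr_T3_0_rec ?(@num_irr_T2_0 p) ?exprS //; lia.
Qed.

Lemma num_irr_T3_0_3 s : (s + 3 = m)%N -> N s T3 0 = q.
Proof.
by move=> sp; rewrite num_irr_T3_0_rec ?num_irr_T2_0_2 ?mulr1 //; lia.
Qed.

Lemma num_irr_T4_0 p s : (s + p.+4.+1 = m)%N -> N s T4 0 = q ^+ p.+4.
Proof.
by move=> sp; rewrite num_irr_T4_0_rec ?(@num_irr_T3_0 p) ?exprS //; lia.
Qed.

Lemma num_irr_T4_0_4 s : (s + 4 = m)%N -> N s T4 0 = q ^+ 2.
Proof.
by move=> sp; rewrite num_irr_T4_0_rec ?num_irr_T3_0_3 ?expr2 //; lia.
Qed.

Lemma num_irr_U23_0 p s : (s + p.+4 = m)%N -> N s U23 0 = q ^+ p.+4.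
Proof.
by move=> sp; rewrite num_irr_U23_0_rec ?(@num_irr_T2_0 p) -?exprD //; lia.
Qed.

Lemma num_irr_U23_0_3 s : (s + 3 = m)%N -> N s U23 0 = q ^+ 2.
Proof.
by move=> sp; rewrite num_irr_U23_0_rec ?num_irr_T2_0_2 ?mulr1 //; lia.
Qed.

Lemma num_irr_U24_0 p s : (s + p.+4.+1 = m)%N -> N s U24 0 = q ^+ p.+4.+1.
Proof.
by move=> sp; rewrite num_irr_U24_0_rec ?(@num_irr_T3_0 p) -?exprD //; lia.
Qed.

Lemma num_irr_U24_0_4 s : (s + 4 = m)%N -> N s U24 0 = q ^+ 3.
Proof.
by move=> sp; rewrite num_irr_U24_0_rec ?num_irr_T3_0_3 -?exprSr //; lia.
Qed.

Lemma num_irr_U12_0 p s : (s + p.+4 = m)%N -> N s U12 0 = q ^+ p.+3.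
Proof.
by move=> sp; rewrite num_irr_U12_0_rec ?(@num_irr_U_0 p.+2) ?exprS //; lia.
Qed.

Lemma num_irr_U12_0_3 s : (s + 3 = m)%N -> N s U12 0 = q.
Proof.
by move=> sp; rewrite num_irr_U12_0_3_rec ?(@num_irr_U_0 1) ?expr1 //; lia.
Qed.

Lemma num_irr_U_1 p s : (s + p.+3 = m)%N ->
  N s [::] 1 = (q - 1) * q ^+ p * (1 + p%:R * q).
Proof.
elim: p s => [|p IH] s sp; rewrite num_irr_U_1_rec; try lia.
  rewrite num_irr_U_1_2_eq0 ?num_irr_T2_0_2; try lia; ring.
rewrite IH ?(@num_irr_T2_0 p); try lia.
by rewrite !exprS -natr1; ring.
Qed.

Lemma num_irr_T2_1 p s : (s + p.+4.+1 = m)%N ->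
  N s T2 1 = (q - 1) * q ^+ p.+2 * (1 + p.+1%:R * q + q ^+ 2).
Proof.
move=> sp; rewrite num_irr_T2_1_rec ?(@num_irr_U_1 p.+1) ?(@num_irr_U23_0 p);
  try lia.
by rewrite !exprS -natr1; ring.
Qed.

Lemma num_irr_T2_1_4 s : (s + 4 = m)%N -> N s T2 1 = (q - 1) * q * (1 + q).
Proof.
by move=> sp; rewrite num_irr_T2_1_rec ?(@num_irr_U_1 0) ?num_irr_U23_0_3;
  try lia; ring.
Qed.

Lemma num_irr_U23_1 p s : (s + p.+4.+2 = m)%N ->
  N s U23 1 = (q - 1) * q ^+ p.+4 * (1 + p.+1%:R * q + q ^+ 2).
Proof.
by move=> sp; rewrite num_irr_U23_1_rec ?(@num_irr_T2_1 p) ?exprS; try lia;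
  ring.
Qed.

Lemma num_irr_U23_1_5 s : (s + 5 = m)%N ->
  N s U23 1 = (q - 1) * q ^+ 3 * (1 + q).
Proof.
by move=> sp; rewrite num_irr_U23_1_rec ?num_irr_T2_1_4; try lia; ring.
Qed.

Lemma num_irr_U23_1_4 s : (s + 4 = m)%N -> N s U23 1 = 0.
Proof.
by move=> sp; rewrite num_irr_U23_1_rec ?num_irr_T2_1_3_eq0 ?mulr0; try lia.
Qed.

Lemma num_irr_T3_1 p s : (s + p.+4.+2 = m)%N ->
  N s T3 1 = (q - 1) * q ^+ p.+3 * (1 + p.+2%:R * q + q ^+ 2).
Proof.
move=> sp; rewrite num_irr_T3_1_rec ?(@num_irr_T2_1 p) ?(@num_irr_U12_0 p.+1);
  try lia.
by rewrite !exprS -!natr1; ring.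
Qed.

Lemma num_irr_T3_1_5 s : (s + 5 = m)%N ->
  N s T3 1 = (q - 1) * q ^+ 2 * (1 + 2 * q).
Proof.
by move=> sp; rewrite num_irr_T3_1_rec ?num_irr_T2_1_4 ?(@num_irr_U12_0 0);
  try lia; ring.
Qed.

Lemma num_irr_T3_1_4 s : (s + 4 = m)%N -> N s T3 1 = (q - 1) * q.
Proof.
by move=> sp; rewrite num_irr_T3_1_rec ?num_irr_T2_1_3_eq0 ?num_irr_U12_0_3;
  try lia; ring.
Qed.

Lemma num_irr_U_2_4 s : (s + 4 = m)%N -> N s [::] 2 = (q - 1) * q.
Proof.
move=> sp; rewrite num_irr_U_2_rec ?num_irr_U_2_3_eq0 ?num_irr_T2_1_3_eq0
  ?num_irr_T3_0_3; try lia; ring.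
Qed.

(** Divided by (q - 1) q^(p+1), the recursion adds to the value for [p] an increment affine in [p];
    the term p (p + 1) / 2 sums its linear part. *)
Lemma num_irr_U_2 p s : (s + p.+4.+1 = m)%N ->
  N s [::] 2 = (q - 1) * q ^+ p.+1 *
    (2 * q ^+ 2 + q - 1 + p%:R * ((q - 1) * (1 + q ^+ 2) + q ^+ 2)
     + (q - 1) * q * (p%:R * (p%:R + 1) / 2)).
Proof.
elim: p s => [|p IH] s sp; rewrite num_irr_U_2_rec; try lia.
  by rewrite num_irr_U_2_4 ?num_irr_T2_1_4 ?(@num_irr_T3_0 0); try lia; field.
rewrite IH ?(@num_irr_T2_1 p) ?(@num_irr_T3_0 p.+1); try lia.
by rewrite !exprS -!natr1; field.
Qed.

Lemma num_irr_T2_2 p s : (s + p.+4.+3 = m)%N ->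
  N s T2 2 = q * ((q - 1) * q ^+ p.+2 *
    (2 * q ^+ 2 + q - 1 + p.+1%:R * ((q - 1) * (1 + q ^+ 2) + q ^+ 2)
     + (q - 1) * q * (p.+1%:R * (p.+1%:R + 1) / 2)))
   + (q - 1) * ((q - 1) * q ^+ p.+4 * (1 + p.+1%:R * q + q ^+ 2)
     + q ^+ p.+4.+2).
Proof.
move=> sp; rewrite num_irr_T2_2_rec ?(@num_irr_U_2 p.+1) ?(@num_irr_U23_1 p)
  ?(@num_irr_U24_0 p.+1); try lia.
by rewrite !exprS; field.
Qed.

Lemma num_irr_T2_2_4 s : (s + 4 = m)%N -> N s T2 2 = 0.
Proof.
by move=> sp; rewrite num_irr_T2_2_4_rec ?num_irr_U_2_3_eq0
  ?num_irr_U23_1_3_eq0; try lia; ring.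
Qed.

Lemma num_irr_T2_2_5 s : (s + 5 = m)%N ->
  N s T2 2 = (q - 1) * (q ^+ 2 + q ^+ 3).
Proof.
by move=> sp; rewrite num_irr_T2_2_rec ?num_irr_U_2_4 ?num_irr_U23_1_4
  ?num_irr_U24_0_4; try lia; ring.
Qed.

Lemma num_irr_T2_2_6 s : (s + 6 = m)%N ->
  N s T2 2 = (q - 1) * (q ^+ 2 * (2 * q ^+ 2 + q - 1)
    + (q - 1) * q ^+ 3 * (1 + q) + q ^+ 5).
Proof.
move=> sp; rewrite num_irr_T2_2_rec ?(@num_irr_U_2 0) ?num_irr_U23_1_5
  ?(@num_irr_U24_0 0); try lia.
ring.
Qed.

Lemma num_irr_U_3_5 s : (s + 5 = m)%N -> N s [::] 3 = q * (q - 1) * (2 * q - 1).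
Proof.
move=> sp; rewrite num_irr_U_3_rec ?num_irr_U_3_4_eq0 ?num_irr_T2_2_4
  ?num_irr_T3_1_4 ?num_irr_T4_0_4; try lia.
ring.
Qed.

Lemma num_irr_U_3_6 s : (s + 6 = m)%N ->
  N s [::] 3 = q ^+ 2 * (q - 1) * (4 * q ^+ 2 + q - 3).
Proof.
move=> sp; rewrite num_irr_U_3_rec ?num_irr_U_3_5 ?num_irr_T2_2_5
  ?num_irr_T3_1_5 ?(@num_irr_T4_0 0); try lia.
ring.
Qed.

Lemma num_irr_U_3_7 s : (s + 7 = m)%N ->
  N s [::] 3 = q ^+ 2 * (q - 1)
    * (3 * q ^+ 4 + 6 * q ^+ 3 - 2 * q ^+ 2 - 5 * q + 1).
Proof.
move=> sp; rewrite num_irr_U_3_rec ?num_irr_U_3_6 ?num_irr_T2_2_6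
  ?(@num_irr_T3_1 0) ?(@num_irr_T4_0 1); try lia.
ring.
Qed.

(** The uniform formula for [T2] in degree q^2 begins at size 7, so this recursion begins at size
    8. *)
Lemma num_irr_U_3 p s (x : rat := (p.+4.+4)%:R) : (s + p.+4.+4 = m)%N ->
  N s [::] 3 = q * N s.+1 [::] 3 + q ^+ p.+3 * (q - 1)
    * (q ^+ 5 + (2 * x - 14) * q ^+ 4
       + (25 - 3 * x + (x - 6) * (x - 5) / 2) * q ^+ 3
       + (x - 11 - (x - 7) * (x - 6)) * q ^+ 2
       + (5 - x + (x - 8) * (x - 7) / 2) * q
       + (x - 6)).
Proof.
move=> sp; rewrite num_irr_U_3_rec ?(@num_irr_T2_2 p) ?(@num_irr_T3_1 p.+1)
  ?(@num_irr_T4_0 p.+2); try lia.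
by rewrite /x !exprS -!natr1; field.
Qed.

End Values.

(** Divided by q^(n-5) (q - 1), with n the size, the recursion becomes a plain sum: each coefficient
    is its value at 7 plus the sum of the coefficients in the braces from 8 to n. *)
Lemma num_irr_U_3_closed n (F : finFieldType) p s (x : rat := p.+4.+3%:R)
    (q : rat := #|F|%:R) : (s + p.+4.+3 = n.-1.+1)%N ->
  num_irr_pattern n F (unitri_pattern s [::]) 3 = q ^+ p.+2 * (q - 1)
    * (A_coef x * q ^+ 5 + B_coef x * q ^+ 4 + C_coef x * q ^+ 3
       + D_coef x * q ^+ 2 + E_coef x * q + F_coef x).
Proof.
rewrite {}/x {}/q /A_coef /B_coef /C_coef /D_coef /E_coef /F_coef.
elim: p s => [|p IH] s sp; first by rewrite num_irr_U_3_7 //; field.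
rewrite (@num_irr_U_3 _ _ p) // IH; last by lia.
by rewrite !exprS -!natr1; field.
Qed.

(** * Unitriangular groups and integrality *)

Lemma unitriangular_pattern n (F : finFieldType) (k : nat) :
  (num_irr_deg 'U_n[F] (#|F| ^ k))%:R =
    num_irr_pattern n F (unitri_pattern 0 [::]) k :> rat.
Proof.
rewrite /num_irr_pattern; congr (num_irr_deg _ _)%:R; apply/val_inj/setP=> g.
rewrite /= -[RHS]/(g \in pattern_group n F _) mem_pattern_group; last first.
  by split=> [? ?|? ? ?]; pat_lia.
apply/unitriangularP/pattern_setP=> gU i j.
  by move=> ij; apply: gU; move: ij; pat_lia.
by move=> ij; apply: gU; move: ij; pat_lia.
Qed.

(** All denominators are absorbed by k = (z^3 - z) / 6 and h = (z^2 + z) / 2. The explicit integers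
    also serve as coefficients of the polynomial in q. *)
Lemma coefs_int (z : int) (x : rat := z%:~R) : exists k h : int,
  [/\ C_coef x = (k - 4 * z ^+ 2 + 36 * z - 106)%:~R,
      D_coef x = (7 * z ^+ 2 - 46 * z + 117 - 2 * k - h)%:~R,
      E_coef x = (k - 4 * z ^+ 2 + 29 * z - 68)%:~R
    & F_coef x = (h - 6 * z + 15)%:~R].
Proof.
have [k kE] : exists k : int, z ^+ 3 - z = 6 * k.
  rewrite (divz_eq z 6); set a := (z %/ 6)%Z.
  have : (z %% 6)%Z \in [:: 0; 1; 2; 3; 4; 5] by rewrite !inE; lia.
  have eqr (r t : int) : r ^+ 3 - r = 6 * t -> (a * 6 + r) ^+ 3 - (a * 6 + r) =
      6 * (36 * a ^+ 3 + 18 * a ^+ 2 * r + 3 * a * r ^+ 2 - a + t).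
    move=> rt; transitivity (6 * (36 * a ^+ 3 + 18 * a ^+ 2 * r
      + 3 * a * r ^+ 2 - a) + (r ^+ 3 - r)); first by ring.
    by rewrite rt; ring.
  rewrite !inE => /or4P[|||/or3P[]] /eqP->; eexists; apply: eqr.
  (* The six witnesses are (r^3 - r) / 6 for the residues r = 0, ..., 5. *)
  - by instantiate (1 := 0).
  - by instantiate (1 := 0).
  - by instantiate (1 := 1).
  - by instantiate (1 := 4).
  - by instantiate (1 := 10).
  - by instantiate (1 := 20).
have [h hE] : exists h : int, z ^+ 2 + z = 2 * h.
  by exists ((z ^+ 2 + z) %/ 2)%Z; nia.
exists k, h.
have kQ : x ^+ 3 = x + 6 * k%:~R.
  have := congr1 (fun y : int => y%:~R : rat) kE.
  rewrite rmorphB rmorphXn rmorphM /= -/x => /eqP; rewrite subr_eq => /eqP->.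
  by rewrite addrC.
have hQ : h%:~R = (x ^+ 2 + x) / 2.
  have := congr1 (fun y : int => y%:~R : rat) hE.
  rewrite rmorphD rmorphXn rmorphM /= -/x => ->.
  by rewrite mulrAC divff ?mul1r.
have kQ' : k%:~R = (x ^+ 3 - x) / 6 by rewrite kQ; field.
by split; rewrite /C_coef /D_coef /E_coef /F_coef
  !(rmorphXn, rmorph_nat, rmorphD, rmorphN, rmorphM) /= ?kQ' ?hQ -/x; field.
Qed.

Theorem mainTheorem3 :
  (forall (q : nat) (F : finFieldType), prime_power q -> #|F| = q ->
     let Q : rat := q%:R in
     let N (n : nat) : rat := (num_irr_deg 'U_n[F] (q ^ 3))%:R in
     [/\ N 5%N = Q * (Q - 1) * (2 * Q - 1),
         N 6%N = Q ^+ 2 * (Q - 1) * (4 * Q ^+ 2 + Q - 3),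
         N 7%N = Q ^+ 2 * (Q - 1)
                 * (3 * Q ^+ 4 + 6 * Q ^+ 3 - 2 * Q ^+ 2 - 5 * Q + 1),
         forall n : nat, (8 <= n)%N ->
           let x : rat := n%:R in
           N n = Q * N n.-1
             + Q ^+ (n - 5) * (Q - 1)
               * (Q ^+ 5 + (2 * x - 14) * Q ^+ 4
                  + (25 - 3 * x + (x - 6) * (x - 5) / 2) * Q ^+ 3
                  + (x - 11 - (x - 7) * (x - 6)) * Q ^+ 2
                  + (5 - x + (x - 8) * (x - 7) / 2) * Q
                  + (x - 6))
       & forall n : nat, (7 <= n)%N ->
           let x : rat := n%:R in
           N n = Q ^+ (n - 5) * (Q - 1)
             * (A_coef x * Q ^+ 5 + B_coef x * Q ^+ 4 + C_coef x * Q ^+ 3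
                + D_coef x * Q ^+ 2 + E_coef x * Q + F_coef x)])
  /\ (forall z : int, let x : rat := z%:~R in
        [/\ A_coef x \is a Num.int, B_coef x \is a Num.int
          & [/\ C_coef x \is a Num.int, D_coef x \is a Num.int,
                E_coef x \is a Num.int & F_coef x \is a Num.int]])
  /\ (forall n : nat, (5 <= n)%N ->
        exists P : {poly int}, forall (q : nat) (F : finFieldType),
          prime_power q -> #|F| = q ->
          (num_irr_deg 'U_n[F] (q ^ 3))%:Z = P.[q%:Z]).
Proof.
have U5 (F : finFieldType) (Q : rat := #|F|%:R) :
    (num_irr_deg 'U_5[F] (#|F| ^ 3))%:R = Q * (Q - 1) * (2 * Q - 1).
  by rewrite unitriangular_pattern num_irr_U_3_5.
have U6 (F : finFieldType) (Q : rat := #|F|%:R) :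
    (num_irr_deg 'U_6[F] (#|F| ^ 3))%:R
      = Q ^+ 2 * (Q - 1) * (4 * Q ^+ 2 + Q - 3).
  by rewrite unitriangular_pattern num_irr_U_3_6.
have Un n (F : finFieldType) (Q : rat := #|F|%:R) (x : rat := n%:R) :
    (7 <= n)%N ->
    (num_irr_deg 'U_n[F] (#|F| ^ 3))%:R = Q ^+ (n - 5) * (Q - 1)
      * (A_coef x * Q ^+ 5 + B_coef x * Q ^+ 4 + C_coef x * Q ^+ 3
         + D_coef x * Q ^+ 2 + E_coef x * Q + F_coef x).
  move=> n7; rewrite /x -(subnK n7) addnC unitriangular_pattern.
  by rewrite (@num_irr_U_3_closed _ _ (n - 7)).
split; last split.
- move=> _ F _ <- Q N; split.
  + exact: U5.
  + exact: U6.
  + by rewrite /N unitriangular_pattern num_irr_U_3_7.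
  (* The pattern recursion compares two patterns inside one ambient group, whereas [N n] and
     [N n.-1] live in different ones. The closed form depends on the size alone, so the recursion is
     read off from its values at n and n - 1. *)
  + move=> n n8; rewrite /N !Un; try lia.
    have [p ->] : exists p, n = p.+4.+4 by exists (n - 8)%N; lia.
    rewrite /= !subSS !subn0 /A_coef /B_coef /C_coef /D_coef /E_coef /F_coef.
    by rewrite !exprS -!natr1; field.
  + by move=> n n7 x; apply: Un.
- move=> z x; have [k [h [-> -> -> ->]]] := coefs_int z.
  rewrite /A_coef /B_coef -/x; split; last by split; apply: intr_int.
    by rewrite rpredB // ?intr_int.
  by rewrite rpredD // rpredM // rpredB // ?intr_int.
move=> n n5.
have hornE := (hornerM, hornerD, hornerN, hornerC, hornerXn, hornerX).
have mor := (rmorphXn, rmorph1, rmorph_nat, rmorphD, rmorphN, rmorphM).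
have [->|[->|n7]] : n = 5%N \/ n = 6%N \/ (7 <= n)%N by lia.
- exists ('X * ('X - 1%:P) * (2%:P * 'X - 1%:P)) => _ F _ <-.
  (* The identity of integers is checked in [rat], where the formula for the number of characters is
     stated. *)
  apply: (@intr_inj rat); rewrite -pmulrn U5 [#|F|%:R]pmulrn !hornE.
  by move: (Posz #|F|) => Q; rewrite !mor; ring.
- exists ('X ^+ 2 * ('X - 1%:P) * (4%:P * 'X ^+ 2 + 'X - 3%:P)) => _ F _ <-.
  apply: (@intr_inj rat); rewrite -pmulrn U6 [#|F|%:R]pmulrn !hornE.
  by move: (Posz #|F|) => Q; rewrite !mor; ring.
have [k [h [Ck Dk Ek Fk]]] := coefs_int n.
set z : int := n%:Z in Ck Dk Ek Fk.
exists ('X ^+ (n - 5) * ('X - 1%:P) * ((z - 7)%:P * 'X ^+ 5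
  + (3 + (z - 7) * (z - 6))%:P * 'X ^+ 4
  + (k - 4 * z ^+ 2 + 36 * z - 106)%:P * 'X ^+ 3
  + (7 * z ^+ 2 - 46 * z + 117 - 2 * k - h)%:P * 'X ^+ 2
  + (k - 4 * z ^+ 2 + 29 * z - 68)%:P * 'X + (h - 6 * z + 15)%:P)) => _ F _ <-.
apply: (@intr_inj rat);
  rewrite -pmulrn Un // Ck Dk Ek Fk /A_coef /B_coef !hornE.
rewrite [#|F|%:R]pmulrn -[n%:R]/(z%:~R); move: (Posz #|F|) (n - 5)%N => Q d.
by rewrite !mor; ring.
Qed.
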